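(* Let $\{X(t)\}_{t\ge 0}$ be the real-valued Lévy process with $\mathbb{E}[e^{iyX(t)}]=\exp(t\psi(y))$ for all $t\ge0$, $y\in\mathbb{R}$, where $$\psi(y)=\int_{0+}^\infty \left(e^{iyx}-1-iyx\,1_{\{x\le 1\}}\right)d\phi(x)$$ and the Lévy measure $\phi$ is concentrated on $\{2^k:k\in\mathbb{Z}\}$ with $\phi(\{2^k\})=2^{-k}$. For $t\in[\frac12,1]$ let $Y(t)=t^{-1}(X(t)-t\log_2 t)$, and let $G_Y([\frac12,1])=\{(t,Y(t)):t\in[\frac12,1]\}\subseteq\mathbb{R}^2$ be the graph. Then almost surely the box-counting dimension of $G_Y([\frac12,1])$ exists and $$\dim_{\rm B} G_Y([\tfrac12,1])=1.$$
   Context: For a bounded set $F\subseteq\mathbb{R}^d$ let $N_\delta(F)$ be the smallest number of closed balls of radius $\delta$ that cover $F$; the box-counting dimension is $\dim_{\rm B}F=\lim_{\delta\to0}\frac{\log N_\delta(F)}{-\log\delta}$, provided the limit exists. $\log_2$ is the logarithm to base $2$. Explicitly, $\psi(y)=\sum_{k\in\mathbb{Z}}2^{-k}\left(e^{iy2^k}-1-iy2^k1_{\{k\le 0\}}\right)$. A Lévy process starts at $0$, has stationary independent increments and càdlàg sample paths. *)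

(* Defs.v *)
From HB Require Import structures.
From mathcomp Require Import all_boot all_order all_algebra.
From mathcomp Require Import all_classical all_reals all_analysis.
From mathcomp Require Import complex.

Set Implicit Arguments.
Unset Strict Implicit.
Unset Printing Implicit Defensive.

Import Order.TTheory GRing.Theory Num.Theory.
Import numFieldTopology.Exports numFieldNormedType.Exports.

Local Open Scope classical_set_scope.
Local Open Scope ring_scope.

Section BoxDimension.
Context {R : realType} {d : nat}.

(* The library norm on 'rV[R]_d is the sup norm, hence the explicit formula. *)
Definition euclidean_closed_ball (c : 'rV[R]_d) (r : R) : set 'rV[R]_d :=
  [set x | Num.sqrt (\sum_(i < d) (x 0 i - c 0 i) ^+ 2) <= r].

Definition coverable (F : set 'rV[R]_d) (delta : R) (n : nat) : Prop :=
  exists c : 'I_n -> 'rV[R]_d,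
    F `<=` \bigcup_(i in [set: 'I_n]) euclidean_closed_ball (c i) delta.

(* The default value 0 is never reached when F is bounded and 0 < delta. *)
Definition covering_number (F : set 'rV[R]_d) (delta : R) : nat :=
  xget 0%N [set n | coverable F delta n /\
                    forall m, coverable F delta m -> (n <= m)%N].

Definition euclidean_bounded (F : set 'rV[R]_d) : Prop :=
  exists r : R, F `<=` euclidean_closed_ball 0 r.

(* The box-counting dimension of the bounded set F exists and equals s. *)
Definition has_box_dimension (F : set 'rV[R]_d) (s : R) : Prop :=
  euclidean_bounded F /\
  ln (covering_number F delta)%:R / - ln delta @[delta --> 0^'+] --> s.

End BoxDimension.

Section ComplexValued.
Context {R : realType}.

Definition cexp (z : R[i]) : R[i] :=
  ((expR (complex.Re z) * cos (complex.Im z)) +i*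
   (expR (complex.Re z) * sin (complex.Im z)))%C.

Definition cintegral {d : measure_display} {T : measurableType d}
    (mu : {measure set T -> \bar R}) (D : set T) (f : T -> R[i]) : R[i] :=
  ((\int[mu]_(x in D) complex.Re (f x)) +i*
   (\int[mu]_(x in D) complex.Im (f x)))%C.

(* phi is the Levy measure; there is neither drift nor Gaussian part. *)
Definition levy_exponent (phi : {measure set R -> \bar R}) (y : R) : R[i] :=
  cintegral phi `]0, +oo[ (fun x =>
    cexp ('i%C * (y * x)%:C%C) - 1 - 'i%C * (y * x * (x <= 1)%R%:R)%:C%C).

End ComplexValued.

Section LevyProcess.
Context {R : realType} {d : measure_display} {T : measurableType d}.
Context (P : probability T R).

(* Processes are indexed by R, but only the times t >= 0 are ever used. *)
Implicit Type X : R -> T -> R.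

Definition char_fun (Z : T -> R) (y : R) : R[i] :=
  cintegral P setT (fun w => cexp ('i%C * (y * Z w)%:C%C)).

Definition stationary_increments X : Prop :=
  forall s h : R, 0 <= s -> 0 <= h -> forall A : set R, measurable A ->
    P [set w | A (X (s + h) w - X s w)] = P [set w | A (X h w - X 0 w)].

(* The product rule for subfamilies is the case where some A i are setT. *)
Definition independent_increments X : Prop :=
  forall (n : nat) (t : nat -> R), 0 <= t 0%N ->
    (forall i, (i < n)%N -> t i <= t i.+1) ->
    forall A : 'I_n -> set R, (forall i, measurable (A i)) ->
      P (\bigcap_(i in [set: 'I_n]) [set w | A i (X (t i.+1) w - X (t i) w)]) =
      (\prod_(i < n) P [set w | A i (X (t i.+1) w - X (t i) w)%R])%E.

Definition cadlag (f : R -> R) : Prop :=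
  (forall t, 0 <= t -> f s @[s --> t^'+] --> f t) /\
  (forall t, 0 < t -> cvg (f s @[s --> t^'-])).

Definition levy_process X : Prop :=
  [/\ forall t, 0 <= t -> measurable_fun [set: T] (X t),
      {ae P, forall w, X 0 w = 0},
      stationary_increments X,
      independent_increments X &
      {ae P, forall w, cadlag (fun t => X t w)}].

End LevyProcess.

Section Graph.
Context {R : realType}.

Definition log2 (t : R) : R := ln t / ln 2.

Definition graph_on (A : set R) (f : R -> R) : set 'rV[R]_2 :=
  [set \row_(i < 2) (if i == 0 then t else f t) | t in A].

End Graph.

(* Main.v *)
(** The Lévy exponent satisfies [|psi y| <= C (1 + n) 2^n] for [0 <= y <= 2^n]:
each of the [n + 1] atoms [2^-n, ..., 1] contributes at most [O(y)], and the other
atoms together [O(2^n)]. The truncation inequality turns this into the tail bound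
[P (|X_t| >= 2 / 2^n) <= 20 t (n + 1) 2^n], and Ottaviani's maximal inequality
transfers it to the supremum of the increments over an interval of length [h].

Cut [[1/2, 1]] into intervals of length [2^-n]. The expected value of
[2^n sum_j min (1, oscillation of X on the j-th interval)] is then at most
[O(n^2 2^n)], so dividing by [n^4 2^n] gives a summable sequence of expectations,
and almost surely the graph is covered by [O(n^4 2^n)] balls of radius [O(2^-n)].
The drift and the factor [1/t] in [Y] cost only [O(1)] more balls per interval.
Conversely a graph over [[1/2, 1]] needs at least [1 / (4 delta)] balls. *)

Require Import Defs.
From HB Require Import structures.
From mathcomp Require Import all_boot all_order all_algebra.
From mathcomp Require Import all_classical all_reals all_analysis.
From mathcomp Require Import measurable_realfun complex ring lra.

Set Implicit Arguments.
Unset Strict Implicit.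
Unset Printing Implicit Defensive.

Import Order.TTheory GRing.Theory Num.Theory.
Import numFieldTopology.Exports numFieldNormedType.Exports.

Local Open Scope classical_set_scope.
Local Open Scope ring_scope.

(** The increments of [X] have no finite mean: for every [k > 0] the atom [2^k] of mass [2^-k] adds
    1 to the first moment. Hence the estimates concern tail probabilities, and oscillations are
    capped at 1. The cap is harmless: a càdlàg path is bounded on [1/2, 1], so a column in which it
    moves by more than 1 still costs only O(2^n) balls. The same scale invariance of the first
    moment puts the factor [n + 1] into the exponent. No effort is made to remove it: at radius
    about 2^-n, a factor polynomial in [n] vanishes from log N / (- log delta). This leaves room for
    crude union bounds over levels. Of the power [n^4], two factors come from the expectation and
    two make the series converge. The oscillation is a supremum over uncountably many times. All
    events are therefore stated at the dyadic times of an interval, where they are measurable and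
    can be reached through finite maxima; right-continuity restores the remaining times afterwards,
    path by path. *)

Section TrigonometricBounds.
Context {R : realType}.
Implicit Type z : R.

Lemma sin_le_id z : 0 <= z -> `|sin z| <= z.
Proof.
move=> z0.
have [|c _] := @MVT_segment R sin cos 0 z z0.
  by apply: continuous_subspaceT; exact: continuous_sin.
rewrite sin0 !subr0 => ->; rewrite normrM (ger0_norm z0).
by rewrite -[leRHS]mul1r ler_wpM2r// cos_max.
Qed.

Lemma one_sub_cos_MVT z : 0 <= z ->
  exists2 c, 0 <= c <= z & 1 - cos z = sin c * z.
Proof.
move=> z0.
have [|c cz] := @MVT_segment R cos (fun x => - sin x) 0 z z0.
- by apply: continuous_subspaceT; exact: continuous_cos.
- rewrite cos0 subr0 => e; exists c; first by move: cz; rewrite in_itv.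
  by rewrite -[LHS]opprB e mulNr opprK.
Qed.

Lemma one_sub_cos_ge0 z : 0 <= 1 - cos z.
Proof. by rewrite subr_ge0 cos_le1. Qed.

Lemma one_sub_cos_le_norm z : 1 - cos z <= `|z|.
Proof.
rewrite -cos_norm; have [c _ ->] := one_sub_cos_MVT (normr_ge0 z).
by rewrite -[leRHS]mul1r ler_wpM2r// sin_le1.
Qed.

Lemma one_sub_cos_le_sqr z : 0 <= z -> 1 - cos z <= z ^+ 2.
Proof.
move=> z0; have [c /andP[c0 cz] ->] := one_sub_cos_MVT z0.
rewrite expr2 ler_wpM2r//; apply: (le_trans (ler_norm _)).
exact: le_trans (sin_le_id c0) cz.
Qed.

Lemma sin_sub_le_sqr z : 0 <= z -> `|sin z - z| <= z ^+ 2.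
Proof.
move=> z0.
have [|c] := @MVT_segment R (fun x => sin x - x) (fun x => cos x - 1) 0 z z0.
- apply: continuous_subspaceT => x; apply: continuousB; first exact: continuous_sin.
  exact: cvg_id.
- rewrite in_itv/= => /andP[c0 cz]; rewrite sin0 !subr0 => ->.
  rewrite normrM (ger0_norm z0) expr2 ler_wpM2r// distrC ger0_norm ?one_sub_cos_ge0//.
  apply: (le_trans (one_sub_cos_le_norm _)); by rewrite ger0_norm.
Qed.

Lemma sin_sub_le z : 0 <= z -> `|sin z - z| <= 2 * z.
Proof.
move=> z0; apply: (le_trans (ler_normB _ _)).
by rewrite (ger0_norm z0) mulrDl mul1r lerD2r sin_le_id.
Qed.

(** Split as [(1 - e^p) + e^p (1 - cos q)]. With [p + i q = t psi(y)] this bounds one minus the real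
    part of the characteristic function linearly in the exponent, imaginary part included, so [X] is
    not symmetrised. *)
Lemma one_sub_expR_cos_le (p q : R) : p <= 0 ->
  1 - expR p * cos q <= `|p| + `|q|.
Proof.
move=> p0; have e1 : expR p <= 1 by rewrite -expR0 ler_expR.
have e2 : 1 - `|p| <= expR p.
  by rewrite ler0_norm// opprK; exact: expR_ge1Dx.
have c := one_sub_cos_le_norm q; have c1 := cos_le1 q.
have e0 := expR_ge0 p.
have : expR p * (1 - cos q) <= 1 * (1 - cos q).
  by rewrite ler_wpM2r// one_sub_cos_ge0.
by rewrite mul1r mulrBr mulr1; lra.
Qed.

End TrigonometricBounds.

(** * Integrals against the dyadic Lévy measure and growth of the exponent *)

Section DyadicLevyMeasure.
Context {R : realType}.

(** Injectivity makes the range a disjoint union of singletons, so the integral is a series over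
    atoms and a uniform bound on its partial sums passes to the limit. *)
Lemma ge0_integral_range_le (mu : {measure set R -> \bar R}) (e : nat -> R)
    (f : R -> R) (B : R) : injective e -> measurable_fun setT f ->
  (forall k, 0 <= f (e k)) ->
  (forall n, (\sum_(k < n) (f (e k))%:E * mu [set e k] <= B%:E)%E) ->
  (\int[mu]_(x in range e) (f x)%:E <= B%:E)%E.
Proof.
move=> ei mf f0 hB.
have -> : range e = \bigcup_k [set e k].
  by rewrite -bigcup_imset1 /=; apply: eq_bigcupl => //; split => x //.
rewrite ge0_integral_bigcup//; last 3 first.
- apply/measurable_EFinP; exact: measurable_funS mf.
- by move=> x [k _ /= ->]; rewrite lee_fin.
- by apply/trivIsetP => i j _ _ ij; apply/eqP/negPn; apply/negP => /set0P[x [/= -> /ei/eqP]];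
    rewrite (negPf ij).
have e1 k : (\int[mu]_(x in [set e k]) (f x)%:E = (f (e k))%:E * mu [set e k])%E.
  by rewrite -(integral_cst mu (measurable_set1 (e k)));
     apply: eq_integral => x; rewrite inE => ->.
under eq_eseriesr do rewrite e1.
apply: lime_le.
  by apply: is_cvg_nneseries => k _ _; rewrite mule_ge0// lee_fin.
by near=> n; rewrite big_mkord.
Unshelve. all: by end_near. Qed.

Lemma geometric_step (a : R) n :
  a * (1 - (2 ^+ n.+1)^-1) = a * (1 - (2 ^+ n)^-1) + a / 2 ^+ n.+1.
Proof. by rewrite exprS; field; rewrite lt0r_neq0// exprn_gt0. Qed.

Variable phi : {measure set R -> \bar R}.
Hypothesis phi_conc : phi (~` range (fun k : int => (2 : R) ^ k)) = 0%E.
Hypothesis phi_atom : forall k : int, phi [set (2 : R) ^ k] = ((2 : R) ^ (- k))%:E.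

(** The atom [x] has mass [1 / x]. So the linear bound contributes the same [2 * 2^n] at every
    scale, which produces the factor [n], while the quadratic bound gives a geometric series once
    [2^n x < 1]. Above 1 the masses themselves are summable. *)
Lemma levy_integral_le (f : R -> R) (n : nat) :
  measurable_fun setT f ->
  (forall x, 0 < x -> 0 <= f x) ->
  (forall x, 1 < x -> f x <= 2) ->
  (forall x, 0 < x <= 1 -> f x <= 2 * 2 ^+ n * x) ->
  (forall x, 0 < x <= 1 -> f x <= (2 ^+ n * x) ^+ 2) ->
  (\int[phi]_(x in `]0%R, +oo[) (f x)%:E <= (5 * n.+1%:R * 2 ^+ n)%:E)%E.
Proof.
move=> mf f0 f1 f2 f3.
have two0 m : 0 < (2 : R) ^+ m by rewrite exprn_gt0.
have ge1 m : 1 <= (2 : R) ^+ m by rewrite exprn_ege1// ler1n.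
have gt1 m : 1 < (2 : R) ^+ m.+1 by rewrite exprn_egt1// ltr1n.
pose e1 (k : nat) : R := 2 ^+ k.
(* [Negz k] is [-(k + 1)], hence the exponent [k.+1]; the atom 1 belongs to [e1]. *)
pose e2 (k : nat) : R := (2 ^+ k.+1)^-1.
have e1i : injective e1.
  by apply: ieexprIn; rewrite ?ltr0n// pnatr_eq1.
have e2i : injective e2 by move=> i j /invr_inj /e1i [].
have le_e2 k : 0 < e2 k <= 1.
  by rewrite invr_gt0 two0/= invf_le1.
have mr e : measurable (range (e : nat -> R)).
  have -> : range e = \bigcup_k [set e k].
    by rewrite -bigcup_imset1 /=; apply: eq_bigcupl => //; split => x //.
  exact: bigcup_measurable.
have rE : range (fun k : int => (2 : R) ^ k) = range e1 `|` range e2.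
  apply/seteqP; split => x /=.
    by move=> [[k|k] _ <-]; [left|right]; exists k.
  by move=> [[k _ <-]|[k _ <-]]; [exists (Posz k)|exists (Negz k)].
rewrite (@ge0_negligible_integral _ _ _ _ _ (~` range (fun k : int => (2 : R) ^ k)))//; last 3 first.
- by rewrite rE; apply: measurableC; apply: measurableU.
- by apply/measurable_EFinP; exact: measurable_funS mf.
- by move=> x /=; rewrite in_itv/= andbT lee_fin; exact: f0.
have -> : `]0, +oo[ `\` ~` range (fun k : int => (2 : R) ^ k) = range e1 `|` range e2.
  rewrite setDE setCK rE; apply/setIidr => x /= [[k _ <-]|[k _ <-]];
    rewrite in_itv/= andbT ?two0//.
  by case/andP: (le_e2 k).
rewrite ge0_integral_setU//; last 3 first.
- apply/measurable_EFinP; exact: measurable_funS mf.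
- move=> x [[k _ <-]|[k _ <-]]; rewrite lee_fin f0//.
  by case/andP: (le_e2 k).
- apply/eqP/seteqP; split => // x /= [[i _ <-] [j _ ij]].
  have /andP[_] := le_e2 j; rewrite ij.
  move: ij; rewrite /e1 /e2; have := gt1 j; rewrite -invf_lt1//.
  by move=> h1 h2; have := ge1 i; rewrite -h2 leNgt h1.
have a1 k : phi [set e1 k] = ((2 ^+ k)^-1)%:E.
  by rewrite (phi_atom (Posz k)) -exprnN.
have a2 k : phi [set e2 k] = (2 ^+ k.+1)%:E.
  by rewrite (phi_atom (Negz k)) NegzE opprK.
(* The first two brackets bound the atoms from 1 upwards and those below 1; the rest is nonnegative
   slack from rounding up to the constant 5. *)
have -> : 5 * n.+1%:R * 2 ^+ n = (2 * 2 ^+ n + 2) + (2 * 2 ^+ n * n%:R + 2 ^+ n)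
    + (3 * n%:R * 2 ^+ n + 2 * (2 ^+ n - 1)) :> R by rewrite -natr1; ring.
have h1 : (\int[phi]_(x in range e1) (f x)%:E <= (2 * 2 ^+ n + 2)%:E)%E.
  apply: ge0_integral_range_le => // [k|N]; first exact/f0/two0.
  under eq_bigr do rewrite a1 -EFinM.
  rewrite sumEFin lee_fin.
  case: N => [|N]; first by rewrite big_ord0 addr_ge0// mulr_ge0// ltW.
  rewrite big_ord_recl/= /e1 expr0 invr1 mulr1 lerD//.
    by have := f2 1; rewrite ltr01 lexx mulr1; apply.
  have : \sum_(i < N) f (2 ^+ bump 0 i) / 2 ^+ bump 0 i <= 2 * (1 - (2 ^+ N)^-1).
    elim: N => [|N IH]; first by rewrite big_ord0 expr0 invr1 subrr mulr0.
    rewrite big_ord_recr/=.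
    rewrite geometric_step lerD//; apply: ler_wpM2r; last exact/f1/gt1.
    by rewrite invr_ge0 ltW.
  move=> /le_trans; apply; rewrite -[leRHS]mulr1 ler_wpM2l// gerBl invr_ge0//.
have h2 : (\int[phi]_(x in range e2) (f x)%:E <= (2 * 2 ^+ n * n%:R + 2 ^+ n)%:E)%E.
  have g0 k : 0 <= f (e2 k) by apply: f0; case/andP: (le_e2 k).
  apply: ge0_integral_range_le => // N.
  under eq_bigr do rewrite a2 -EFinM.
  rewrite sumEFin lee_fin.
  (* Padding the sum with [n] nonnegative terms lets it be split at index [n], where the quadratic
     bound takes over, whatever [N] is. *)
  apply: (@le_trans _ _ (\sum_(i < n + N) f (e2 i) * 2 ^+ i.+1)).
    rewrite addnC big_split_ord/= lerDl sumr_ge0// => i _.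
    by rewrite mulr_ge0// ltW.
  rewrite big_split_ord/= lerD//.
    have -> : 2 * 2 ^+ n * n%:R = \sum_(i < n) 2 * 2 ^+ n :> R.
      by rewrite sumr_const card_ord mulr_natr.
    apply: ler_sum => i _.
    rewrite -ler_pdivlMr//; exact: f2.
  have : \sum_(i < N) f (e2 (n + i)%N) * 2 ^+ (n + i).+1 <= 2 ^+ n * (1 - (2 ^+ N)^-1).
    elim: N => [|N IH]; first by rewrite big_ord0 expr0 invr1 subrr mulr0.
    rewrite big_ord_recr/=.
    rewrite geometric_step lerD// -ler_pdivlMr//; apply: (le_trans (f3 _ (le_e2 _))).
    rewrite /e2 le_eqVlt; apply/orP; left; apply/eqP.
    by rewrite -addnS exprD; field; rewrite !lt0r_neq0.
  move=> /le_trans; apply; rewrite -[leRHS]mulr1; apply: ler_wpM2l; first exact: ltW.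
  by rewrite gerBl invr_ge0 ltW.
apply: (le_trans (leeD h1 h2)).
by rewrite -EFinD lee_fin lerDl addr_ge0// ?mulr_ge0// ?subr_ge0.
Qed.

End DyadicLevyMeasure.

Section LevyExponent.
Context {R : realType}.

Lemma cexp_imaginary (a : R) : cexp ('i%C * a%:C%C) = (cos a +i* sin a)%C.
Proof. by rewrite /cexp; simpc; rewrite /= expR0 !mul1r. Qed.

Lemma Re_cintegral {d : measure_display} {T : measurableType d}
    (mu : {measure set T -> \bar R}) (D : set T) (f : T -> R[i]) :
  complex.Re (cintegral mu D f) = \int[mu]_(x in D) complex.Re (f x).
Proof. by []. Qed.

Lemma Im_cintegral {d : measure_display} {T : measurableType d}
    (mu : {measure set T -> \bar R}) (D : set T) (f : T -> R[i]) :
  complex.Im (cintegral mu D f) = \int[mu]_(x in D) complex.Im (f x).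
Proof. by []. Qed.

Lemma measurable_cosM (y : R) : measurable_fun setT (fun x : R => cos (y * x)).
Proof.
apply: continuous_measurable_fun => x.
by apply: continuous_comp; [exact: mulrl_continuous|exact: continuous_cos].
Qed.

Lemma measurable_sinM (y : R) : measurable_fun setT (fun x : R => sin (y * x)).
Proof.
apply: continuous_measurable_fun => x.
by apply: continuous_comp; [exact: mulrl_continuous|exact: continuous_sin].
Qed.

Variable phi : {measure set R -> \bar R}.

Lemma Re_levy_exponent y :
  complex.Re (levy_exponent phi y) = \int[phi]_(x in `]0, +oo[) (cos (y * x) - 1).
Proof.
rewrite /levy_exponent Re_cintegral; apply: eq_Rintegral => x _.
by rewrite cexp_imaginary !raddfB/= !(mulr0, mul0r, oppr0, addr0).
Qed.

Lemma Im_levy_exponent y :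
  complex.Im (levy_exponent phi y) =
  \int[phi]_(x in `]0, +oo[) (sin (y * x) - y * x * (x <= 1)%R%:R).
Proof.
rewrite /levy_exponent Im_cintegral; apply: eq_Rintegral => x _.
by rewrite cexp_imaginary !raddfB/= !(mulr0, mul0r, mul1r, oppr0, add0r, addr0).
Qed.

Lemma Re_levy_exponent_le0 y : complex.Re (levy_exponent phi y) <= 0.
Proof.
rewrite Re_levy_exponent /Rintegral.
under eq_integral do rewrite -opprB EFinN.
rewrite integral_ge0N; last by move=> x _; rewrite lee_fin one_sub_cos_ge0.
by rewrite fineN oppr_le0 fine_ge0// integral_ge0.
Qed.

Hypothesis phi_conc : phi (~` range (fun k : int => (2 : R) ^ k)) = 0%E.
Hypothesis phi_atom : forall k : int, phi [set (2 : R) ^ k] = ((2 : R) ^ (- k))%:E.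

Lemma levy_Rintegral_le (g : R -> R) (n : nat) :
  measurable_fun setT g ->
  (forall x, 1 < x -> `|g x| <= 2) ->
  (forall x, 0 < x <= 1 -> `|g x| <= 2 * 2 ^+ n * x) ->
  (forall x, 0 < x <= 1 -> `|g x| <= (2 ^+ n * x) ^+ 2) ->
  `|\int[phi]_(x in `]0, +oo[) g x| <= 5 * n.+1%:R * 2 ^+ n.
Proof.
move=> mg g1 g2 g3; rewrite /Rintegral.
have : (`|\int[phi]_(x in `]0%R, +oo[) (g x)%:E| <= (5 * n.+1%:R * 2 ^+ n)%:E)%E.
  apply: (@le_trans _ _ (\int[phi]_(x in `]0%R, +oo[) `|(g x)%:E|)%E).
    by apply: le_abse_integral => //; apply/measurable_EFinP; exact: measurable_funS mg.
  apply: (levy_integral_le phi_conc phi_atom (f := fun x => `|g x|)) => //.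
  exact: measurableT_comp.
by case: (\int[phi]_(x in _) _)%E => //= r; rewrite lee_fin normr0.
Qed.

(** For [x <= 1] the compensator cancels the first order of the sine, which gives the quadratic
    bound; for [x > 1] the indicator removes it, which keeps the integrand bounded. *)
Lemma levy_exponent_le (y : R) (n : nat) : 0 <= y <= 2 ^+ n ->
  `|complex.Re (levy_exponent phi y)| <= 5 * n.+1%:R * 2 ^+ n /\
  `|complex.Im (levy_exponent phi y)| <= 5 * n.+1%:R * 2 ^+ n.
Proof.
move=> /andP[y0 yn].
have mono x : 0 < x -> 0 <= y * x <= 2 ^+ n * x.
  by move=> /ltW x0; rewrite mulr_ge0//= ler_wpM2r.
have n0 : 0 <= (2 : R) ^+ n by rewrite exprn_ge0.
rewrite Re_levy_exponent Im_levy_exponent; split; apply: levy_Rintegral_le.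
- by apply: measurable_funB => //; exact: measurable_cosM.
- move=> x _; rewrite distrC ger0_norm ?one_sub_cos_ge0//.
  by rewrite lerBlDr -lerBlDl; apply: le_trans (cos_geN1 _); lra.
- move=> x /andP[/mono/andP[h1 h2] _].
  rewrite distrC ger0_norm ?one_sub_cos_ge0//.
  apply: (le_trans (one_sub_cos_le_norm _)); rewrite ger0_norm//; lra.
- move=> x /andP[/mono/andP[h1 h2] _].
  rewrite distrC ger0_norm ?one_sub_cos_ge0//.
  by apply: (le_trans (one_sub_cos_le_sqr h1)); rewrite lerXn2r// nnegrE; lra.
- apply: measurable_funB => //; first exact: measurable_sinM.
  apply: measurable_funM; first exact: measurable_funM.
  rewrite [X in measurable_fun _ X](_ : _ = (\1_`]-oo, (1:R)] : R -> R)).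
    exact: measurable_indic.
  by apply/funext => x; rewrite indicE mem_setE in_itv.
- move=> x x1; rewrite (lt_geF x1) mulr0 subr0.
  by apply: (le_trans (sin_max _)); rewrite ler1n.
- move=> x /andP[/mono/andP[h1 h2] x1]; rewrite x1 mulr1.
  apply: (le_trans (sin_sub_le h1)); lra.
- move=> x /andP[/mono/andP[h1 h2] x1]; rewrite x1 mulr1.
  by apply: (le_trans (sin_sub_le_sqr h1)); rewrite lerXn2r// nnegrE; lra.
Qed.

End LevyExponent.

(** * From characteristic functions to tails of increments *)

Section CharacteristicFunction.
Context {R : realType} {d : measure_display} {T : measurableType d}.
Variable P : probability T R.

Lemma Re_char_fun (Z : T -> R) y :
  complex.Re (char_fun P Z y) = \int[P]_w cos (y * Z w).
Proof.
rewrite /char_fun Re_cintegral; apply: eq_Rintegral => w _.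
by rewrite cexp_imaginary.
Qed.

Lemma integral_one_sub_cos (Z : T -> R) y : measurable_fun setT Z ->
  (\int[P]_w (1 - cos (y * Z w))%:E = (1 - complex.Re (char_fun P Z y))%:E)%E.
Proof.
move=> mZ; rewrite Re_char_fun.
have mc : measurable_fun setT (fun w => cos (y * Z w)).
  exact: (measurableT_comp (measurable_cosM y)).
have ic : P.-integrable setT (EFin \o (fun w => cos (y * Z w))).
  apply: (@le_integrable _ _ _ P setT measurableT _ (cst 1%E)).
  - exact/measurable_EFinP.
  - by move=> w _ /=; rewrite normr1 lee_fin cos_max.
  - exact: finite_measure_integrable_cst.
under eq_integral do rewrite EFinB.
rewrite integralB//; last exact: finite_measure_integrable_cst.
rewrite integral_cst// [X in (1 * X)%E](_ : _ = 1%E); last exact: probability_setT.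
rewrite mule1 EFinB; congr (_ - _)%E.
by rewrite /Rintegral fineK//; exact: integrable_fin_num.
Qed.

End CharacteristicFunction.

Section MeasurableNorm.
Context {R : realType} {d : measure_display} {T : measurableType d}.
Implicit Types (f : T -> R) (c : R).

Lemma measurable_le_norm c f : measurable_fun setT f ->
  measurable [set w | c <= `|f w|].
Proof.
move=> mf; have mn : measurable_fun setT (fun w => `|f w|) by exact: measurableT_comp.
have := mn measurableT [set` `[c, +oo[] (measurable_itv _).
rewrite setTI; congr measurable; apply/seteqP.
by split => w /=; rewrite in_itv/= andbT.
Qed.

End MeasurableNorm.

Section TruncationInequality.
Context {R : realType}.
Notation leb := (@lebesgue_measure R).

Lemma integral_one_sub_cosM (u z : R) : 0 < u -> z != 0 ->
  (\int[leb]_(y in `[0%R, u]) (1 - cos (y * z))%:E = (u - sin (u * z) / z)%:E)%E.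
Proof.
move=> u0 z0.
pose F (y : R) : R := y - sin (y * z) / z.
have dF (y : R) : is_derive y 1 F (1 - cos (y * z)).
  have -> : F = (id : R -> R) - z^-1 *: (sin \o (z *: (id : R -> R))).
    apply/funext => x; rewrite -[RHS]/(x - z^-1 * sin (z * x)).
    by rewrite [z * x]mulrC [z^-1 * _]mulrC.
  apply: trigger_derive; rewrite /GRing.scale /=.
  by rewrite mulr1 mulrCA mulVf// mulr1 -[z *: y]/(z * y) [z * y]mulrC.
have cF : continuous F.
  by move=> y; apply/differentiable_continuous/derivable1_diffP; have [] := dF y.
rewrite (@continuous_FTC2 R _ F)//.
- by rewrite /F mul0r sin0 mul0r !subr0 -EFinB subr0.
- apply: continuous_subspaceT => y; apply: cvgB; first exact: cvg_cst.
  by apply: continuous_comp; [exact: mulrr_continuous|exact: continuous_cos].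
- split.
  + by move=> y _; have [] := dF y.
  + exact: (cvg_at_right_filter (cF _)).
  + exact: (cvg_at_left_filter (cF _)).
- by move=> y _; rewrite derive1E; have [_ ->] := dF y.
Qed.

Context {d : measure_display} {T : measurableType d}.
Variable P : probability T R.

(* Averaging [1 - cos (y Z)] over [y] in [0, u] gives [1 - sin (u Z) / (u Z)],
   which is at least 1/2 as soon as [2 <= u |Z|]. *)
Lemma truncation_inequality (Z : T -> R) (u B : R) :
  measurable_fun setT Z -> 0 < u -> 0 <= B ->
  (forall y, 0 <= y <= u -> (\int[P]_w (1 - cos (y * Z w))%:E <= B%:E)%E) ->
  (P [set w | (2 / u <= `|Z w|)%R] <= (2 * B)%:E)%E.
Proof.
move=> mZ u0 B0 hB.
pose I := [set` `[0, u]] : set R.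
have mI : measurable I by exact: measurable_itv.
have mI1 : measurable_fun setT (\1_I : R -> R) by exact: measurable_indic.
(* The interval enters as an indicator so that Tonelli applies on the full product; [lower] and
   [upper] estimate the two iterated integrals. *)
pose f (p : T * R) : \bar R := ((1 - cos (p.2 * Z p.1)) * \1_I p.2)%:E.
have f0 p : (0 <= f p)%E.
  by rewrite lee_fin mulr_ge0// one_sub_cos_ge0.
have mf : measurable_fun setT f.
  apply/measurable_EFinP; apply: measurable_funM.
    apply: measurable_funB => //; apply: measurableT_comp.
      by apply: continuous_measurable_fun; exact: continuous_cos.
    apply: measurable_funM; first exact: measurable_snd.
    by apply: (measurableT_comp mZ (g := fst)); exact: measurable_fst.
  by apply: (measurableT_comp mI1 (g := snd)); exact: measurable_snd.
have mA := measurable_le_norm (2 / u) mZ.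
have inner w : (\int[leb]_y f (w, y) =
    \int[leb]_(y in I) (1 - cos (y * Z w))%:E)%E.
  rewrite [RHS]integral_mkcond; apply: eq_integral => y _.
  by rewrite /f patchE/= indicE; case: ifPn; rewrite ?mulr1 ?mulr0.
have lower : ((u / 2)%:E * P [set w | (2 / u <= `|Z w|)%R] <=
    \int[P]_w \int[leb]_y f (w, y))%E.
  rewrite -[X in P X]setIT -integral_indic// -ge0_integralZl//; last 2 first.
  - by apply/measurable_EFinP; exact: measurable_indic.
  - by rewrite lee_fin divr_ge0// ltW.
  apply: ge0_le_integral => //.
  - by move=> w _; rewrite -EFinM lee_fin mulr_ge0// divr_ge0// ltW.
  - by apply: measurable_funeM; apply/measurable_EFinP; exact: measurable_indic.
  - exact: measurable_fun_fubini_tonelli_F.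
  move=> w _; rewrite indicE; case: (boolP (w \in _)); last first.
    by move=> _; rewrite mule0; apply: integral_ge0.
  rewrite inE/= mule1 => hz.
  have z0 : 0 < `|Z w| by apply: lt_le_trans hz; rewrite divr_gt0.
  rewrite inner integral_one_sub_cosM//; last by rewrite -normr_gt0.
  rewrite lee_fin.
  have : sin (u * Z w) / Z w <= u / 2.
    apply: (le_trans (ler_norm _)); rewrite normrM normfV.
    rewrite ler_pdivrMr//; apply: (le_trans (sin_max _)).
    by move: hz; rewrite ler_pdivrMr// => hz; lra.
  lra.
have upper : (\int[leb]_y \int[P]_w f (w, y) <= (u * B)%:E)%E.
  have -> : (u * B)%:E = (\int[leb]_y (B%:E * (\1_I y)%:E))%E.
    rewrite ge0_integralZl//; last exact/measurable_EFinP.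
    rewrite integral_indic//= setIT /I lebesgue_measure_itv/= lte_fin u0.
    by rewrite -EFinB subr0 -EFinM mulrC.
  apply: ge0_le_integral => //.
  - by move=> y _; apply: integral_ge0.
  - exact: measurable_fun_fubini_tonelli_G.
  - by apply: measurable_funeM; apply/measurable_EFinP; exact: measurable_indic.
  move=> y _; rewrite /f/=; have [Iy|nIy] := pselect (I y).
    have -> : \1_I y = 1 :> R by rewrite indicE mem_set.
    rewrite mule1; under eq_integral do rewrite mulr1.
    by apply: hB; move: Iy; rewrite /I/= in_itv.
  have -> : \1_I y = 0 :> R by rewrite indicE memNset.
  by under eq_integral do rewrite mulr0; rewrite integral0 mule0.
have : ((u / 2)%:E * P [set w | (2 / u <= `|Z w|)%R] <= (u * B)%:E)%E.
  apply: (le_trans lower); apply: le_trans upper; rewrite le_eqVlt.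
  by apply/orP; left; apply/eqP; exact: (@fubini_tonelli _ _ _ _ _ P leb f mf f0).
have : P [set w | (2 / u <= `|Z w|)%R] \is a fin_num by exact: fin_num_measure.
move=> /fineK <-; rewrite -EFinM !lee_fin => h.
by rewrite -(ler_pM2l u0); lra.
Qed.

End TruncationInequality.

Section LevyTail.
Context {R : realType} {d : measure_display} {T : measurableType d}.
Variables (P : probability T R) (phi : {measure set R -> \bar R}).
Hypothesis phi_conc : phi (~` range (fun k : int => (2 : R) ^ k)) = 0%E.
Hypothesis phi_atom : forall k : int, phi [set (2 : R) ^ k] = ((2 : R) ^ (- k))%:E.
Variable X : R -> T -> R.
Hypothesis X_levy : levy_process P X.
Hypothesis X_char : forall t y : R, 0 <= t ->
  char_fun P (X t) y = cexp (t%:C%C * levy_exponent phi y).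

(** Truncation at [u = 2^n]. The constant is twice the sum of the two bounds with factor 5, one for
    the real and one for the imaginary part of the exponent. *)
Lemma levy_marginal_tail (t : R) (n : nat) : 0 <= t ->
  (P [set w | (2 / 2 ^+ n <= `|X t w|)%R] <= (20 * t * n.+1%:R * 2 ^+ n)%:E)%E.
Proof.
move=> t0; have [mX _ _ _ _] := X_levy.
have n0 : 0 < (2 : R) ^+ n by rewrite exprn_gt0.
have -> : 20 * t * n.+1%:R * 2 ^+ n = 2 * (10 * t * n.+1%:R * 2 ^+ n) :> R by ring.
apply: truncation_inequality => //; first exact: mX.
  by rewrite !mulr_ge0// ltW.
move=> y yn; rewrite integral_one_sub_cos; last exact: mX.
rewrite lee_fin X_char// /cexp.
have [h1 h2] := levy_exponent_le phi_conc phi_atom yn.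
have := Re_levy_exponent_le0 phi y.
case: (levy_exponent phi y) h1 h2 => a b /= h1 h2 a0.
rewrite !mul0r subr0 addr0.
have ta : t * a <= 0 by rewrite mulr_ge0_le0.
apply: (le_trans (one_sub_expR_cos_le _ ta)).
rewrite !normrM (ger0_norm t0).
have -> : 10 * t * n.+1%:R * 2 ^+ n =
  t * (5 * n.+1%:R * 2 ^+ n) + t * (5 * n.+1%:R * 2 ^+ n) :> R by ring.
by rewrite lerD// ler_wpM2l.
Qed.

Lemma levy_increment_measurable (s t : R) : 0 <= s -> 0 <= t ->
  measurable_fun setT (fun w => X t w - X s w).
Proof. by have [mX _ _ _ _] := X_levy => s0 t0; apply: measurable_funB; exact: mX. Qed.

Lemma levy_increment_tail (s t : R) (n : nat) : 0 <= s <= t ->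
  (P [set w | (2 / 2 ^+ n <= `|X t w - X s w|)%R] <=
    (20 * (t - s) * n.+1%:R * 2 ^+ n)%:E)%E.
Proof.
move=> /andP[s0 st]; have [mX X0 Xs _ _] := X_levy.
have h0 : 0 <= t - s by rewrite subr_ge0.
apply: le_trans (levy_marginal_tail n h0).
pose B := [set x : R | 2 / 2 ^+ n <= `|x|].
have mB : measurable B by exact: (@measurable_le_norm R _ _ _ id).
have := Xs s (t - s) s0 h0 B mB; rewrite subrKC /B /= => ->.
have mXc := measurable_le_norm (2 / 2 ^+ n) (mX _ h0).
have mXd := measurable_le_norm (2 / 2 ^+ n) (levy_increment_measurable (lexx 0) h0).
(* [X 0] vanishes only almost surely, so the events for [X h - X 0] and [X h] are compared after
   adding a null set. *)
have [N [mN N0 XN]] := X0.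
rewrite -(measureU0 mXc mN N0); apply: le_measure; rewrite ?inE//.
  exact: measurableU.
move=> w /= h; have [Nw|nNw] := pselect (N w); [by right|left].
by move: h; rewrite (contra_notP (XN w) nNw) subr0.
Qed.

End LevyTail.

(** * Independence of the past and Ottaviani's inequality *)

Section PastIndependence.
Context {R : realType} {d : measure_display} {T : measurableType d}.
Variables (P : probability T R) (k : nat) (D : nat -> T -> R) (E : set T).
Hypothesis mD : forall i, measurable_fun setT (D i).
Hypothesis mE : measurable E.

(** A pi-system that generates the sigma-algebra of the first [k] variables [D i]. *)
Definition past_rectangles : set (set T) :=
  [set S | exists2 A : nat -> set R, forall i, measurable (A i) &
     S = \bigcap_(i in `I_k) [set w | A i (D i w)]].

Hypothesis independent_rectangles : forall S,
  past_rectangles S -> P (S `&` E) = (P S * P E)%E.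

Lemma measurable_past_rectangles S : past_rectangles S -> measurable S.
Proof.
move=> [A mA ->]; apply: bigcap_measurableType => i _.
by rewrite -[X in measurable X]setTI; exact: mD.
Qed.

Lemma measurable_past S : <<s past_rectangles >> S -> measurable S.
Proof.
apply: smallest_sub; last exact: measurable_past_rectangles.
exact: sigma_algebra_measurable.
Qed.

(** First-passage events are not rectangles, so independence has to be extended beyond them. The
    events independent of [E] form a Dynkin class, and the pi-lambda theorem applies. *)
Lemma independent_past S : <<s past_rectangles >> S -> P (S `&` E) = (P S * P E)%E.
Proof.
apply: (@dynkin_induction _ (g_sigma_algebraType past_rectangles) past_rectangles
  (fun S => P (S `&` E) = (P S * P E)%E)) => //.
- move=> _ _ [A mA ->] [B mB ->]; exists (fun i => A i `&` B i).
    by move=> i; exact: measurableI.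
  by rewrite -bigcapI.
- by rewrite setTI [X in (X * _)%E](_ : _ = 1%E) ?mul1e//; exact: probability_setT.
- move=> V /measurable_past mV PV.
  have fE := fin_num_measure P E mE; have fV := fin_num_measure P V mV.
  have hD : P (E `\` V) = (P E - P (E `&` V))%E.
    by apply: measureD => //; rewrite ltey_eq fE.
  rewrite setIC -setDE hD setIC PV probability_setC//.
  by rewrite -(fineK fE) -(fineK fV) -EFinM -!EFinB -EFinM mulrBl mul1r.
- move=> F mF tF PF; have fE := fin_num_measure P E mE.
  have mF' n : d.-measurable (F n : set T) by apply: measurable_past; exact: mF.
  have h1 : P (\bigcup_k (F k `&` E)) = (\sum_(n <oo) P (F n `&` E))%E.
    apply: measure_semi_bigcup; last by apply: bigcup_measurable => n _; exact: measurableI.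
      by move=> n; exact: measurableI.
    exact: trivIset_setIr.
  have h2 : P (\bigcup_k F k) = (\sum_(n <oo) P (F n))%E.
    by apply: measure_semi_bigcup => //; exact: bigcup_measurable.
  rewrite setI_bigcupl h1 h2 muleC -(fineK fE) -nneseriesZl//.
  by apply: eq_eseriesr => n _; rewrite PF fineK// muleC.
Qed.

Lemma measurable_past_increment i : (i < k)%N ->
  measurable_fun [set: g_sigma_algebraType past_rectangles] (D i).
Proof.
move=> ik _ B mB; rewrite setTI; apply: sub_sigma_algebra.
exists (fun j => if j == i then B else setT); first by move=> j; case: ifP.
apply/seteqP; split => w /=.
  by move=> Bw j _; case: ifPn => // /eqP ->.
by move=> /(_ i ik); rewrite eqxx.
Qed.

End PastIndependence.

Section MaximalInequality.
Context {R : realType} {d : measure_display} {T : measurableType d}.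
Variables (P : probability T R) (X : R -> T -> R).
Hypothesis X_levy : levy_process P X.
Variable t : nat -> R.
Hypothesis t0 : 0 <= t 0%N.
Hypothesis t_nd : forall i, t i <= t i.+1.

Let D i w := X (t i.+1) w - X (t i) w.

Let t_mono : {homo t : i j / (i <= j)%N >-> i <= j}.
Proof. exact: homo_leq le_trans t_nd. Qed.

Let t_ge0 i : 0 <= t i.
Proof. exact: le_trans t0 (t_mono (leq0n i)). Qed.

Let mD i : measurable_fun setT (D i).
Proof. exact: (levy_increment_measurable X_levy). Qed.

Lemma levy_rectangles_independent (k N : nat) (B : set R) : (k <= N)%N ->
  measurable B -> forall S, past_rectangles k D S ->
  P (S `&` [set w | B (X (t N) w - X (t k) w)]) =
  (P S * P [set w | B (X (t N) w - X (t k) w)%R])%E.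
Proof.
move=> kN mB _ [A mA ->]; have [_ _ _ Xi _] := X_levy.
(* These times go from [t k] straight to [t N], which makes the future increment the last of [k + 1]
   consecutive increments. *)
pose t' i := if (i <= k)%N then t i else t N.
have t'k i : (i <= k)%N -> t' i = t i by rewrite /t' => ->.
have t'S : t' k.+1 = t N by rewrite /t' ltnn.
have t'_nd i : (i < k.+1)%N -> t' i <= t' i.+1.
  rewrite ltnS leq_eqVlt => /orP[/eqP ->|ik]; last by rewrite !t'k// ltnW.
  by rewrite t'k// t'S; exact: t_mono.
pose A' (C : set R) (i : nat) := if (i < k)%N then A i else C.
have mA' (C : set R) : measurable C -> forall i : 'I_k.+1, measurable (A' C i).
  by move=> mC i; rewrite /A'; case: ifP.
have cap C : \bigcap_(i in [set: 'I_k.+1]) [set w | A' C i (X (t' i.+1) w - X (t' i) w)] =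
    (\bigcap_(i in `I_k) [set w | A i (D i w)]) `&` [set w | C (X (t N) w - X (t k) w)].
  apply/seteqP; split => w /=.
    move=> h; split => [i ik|].
      have ik1 : (i < k.+1)%N by exact: ltnW.
      by have := h (Ordinal ik1) I; rewrite /A'/= ik !t'k// ltnW.
    by have := h ord_max I; rewrite /A'/= ltnn t'S t'k.
  move=> [h hC] [i ik1] _ /=; rewrite /A'; case: ifPn => ik.
    by rewrite !t'k ?(ltnW ik)//; exact: h.
  have -> : i = k by apply/eqP; rewrite eqn_leq -ltnS ik1 leqNgt.
  by rewrite t'S t'k.
have prod C : measurable C -> P (\bigcap_(i in [set: 'I_k.+1])
      [set w | A' C i (X (t' i.+1) w - X (t' i) w)]) =
    ((\prod_(i < k) P [set w | A i (D i w)]) * P [set w | C (X (t N) w - X (t k) w)%R])%E.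
  move=> mC; rewrite (Xi k.+1 t' _ t'_nd (fun i => A' C i) (mA' C mC)) ?t'k//.
  rewrite big_ord_recr/= /A' ltnn t'S t'k//; congr (_ * _)%E.
  by apply: eq_bigr => i _; rewrite ltn_ord !t'k// ltnW.
(* The choice [C = setT] identifies the product over the first [k] increments with [P S]. *)
have := prod setT measurableT; rewrite cap setIT.
have -> : P [set w | setT (X (t N) w - X (t k) w)] = 1%E by exact: probability_setT.
by rewrite mule1 => ->; rewrite -cap prod.
Qed.

(** Let [A k] be the event that the displacement first reaches [2 b] at index [k]. Either the end
    value is still [b] away from the start, with probability at most [q], or some [A k] is followed
    by a return of at least [b]. By independence and disjointness the latter costs at most [q] times
    the sum of the [P (A k)]. Bounding the two cases additively avoids the usual division by
    [1 - q]. *)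
Lemma levy_maximal_inequality (N : nat) (b q : R) : 0 <= q ->
  (forall k, (k <= N)%N -> (P [set w | (b <= `|X (t N) w - X (t k) w|)%R] <= q%:E)%E) ->
  (P (\bigcup_(k in `I_N.+1) [set w | (2 * b <= `|X (t k) w - X (t 0%N) w|)%R]) <=
    (2 * q)%:E)%E.
Proof.
move=> q0 hq.
pose S k := [set w | 2 * b <= `|X (t k) w - X (t 0%N) w|].
pose E k := [set w | b <= `|X (t N) w - X (t k) w|].
pose A k := S k `\` \bigcup_(j in `I_k) S j.
have mS k : measurable (S k).
  exact/measurable_le_norm/(levy_increment_measurable X_levy).
have mE k : measurable (E k).
  exact/measurable_le_norm/(levy_increment_measurable X_levy).
(* The displacement up to index [j] telescopes into the first [j] increments, hence belongs to the
   past of [k]. *)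
have past_S k j : (j <= k)%N -> <<s past_rectangles k D >> (S j).
  move=> jk; apply: (@measurable_le_norm R _ (g_sigma_algebraType (past_rectangles k D))).
  rewrite [X in measurable_fun _ X](_ : _ = (fun w => \sum_(i < j) D i w)).
    apply: measurable_sum => i; apply: measurable_past_increment.
    exact: leq_trans (ltn_ord i) jk.
  apply/funext => w; rewrite /D.
  by rewrite -(big_mkord xpredT (fun i => X (t i.+1) w - X (t i) w)) telescope_sumr.
have past_A k : <<s past_rectangles k D >> (A k).
  apply: (@measurableD _ (g_sigma_algebraType (past_rectangles k D))).
    exact: past_S.
  apply: (@bigcup_measurable _ (g_sigma_algebraType (past_rectangles k D))) => j jk.
  by apply: past_S; exact: ltnW.
have mA k : measurable (A k).
  by apply: measurableD => //; apply: bigcup_measurable.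
have tA : trivIset setT A.
  apply: ltn_trivIset => j i ij; apply/seteqP; split => // w /= [[Si _] [_ nS]].
  by apply: nS; exists i.
have SA : \bigcup_(k in `I_N.+1) S k = \bigcup_(k in `I_N.+1) A k.
  apply/seteqP; split => w /= [k kN]; last by case=> Sk _; exists k.
  elim/ltn_ind: k kN => k IH kN Sk.
  have [[j jk Sj]|h] := pselect ((\bigcup_(j in `I_k) S j) w).
    by apply: (IH j) => //=; exact: ltn_trans kN.
  by exists k.
rewrite -[X in P X]/(\bigcup_(k in `I_N.+1) S k) SA.
have mU : measurable (\bigcup_(k in `I_N.+1) A k) by exact: bigcup_measurable.
have cover : \bigcup_(k in `I_N.+1) A k `<=`
    E 0%N `|` \bigcup_(k in `I_N.+1) (A k `&` E k).
  move=> w [k kN Ak]; have [Ek|nEk] := pselect (E k w); first by right; exists k.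
  left; have [Sk _] := Ak; move: Sk nEk; rewrite /S /E/= => Sk /negP.
  rewrite -ltNge => nEk.
  have := ler_normB (X (t N) w - X (t 0%N) w) (X (t N) w - X (t k) w).
  have -> : X (t N) w - X (t 0%N) w - (X (t N) w - X (t k) w) = X (t k) w - X (t 0%N) w by ring.
  lra.
have indep k : (k <= N)%N -> P (A k `&` E k) = (P (A k) * P (E k))%E.
  move=> kN; apply: (@independent_past _ _ _ P k D (E k) mD (mE k)) => //.
  apply: (@levy_rectangles_independent k N [set x | b <= `|x|] kN).
  exact: (@measurable_le_norm R _ _ _ id).
have mAE k : measurable (A k `&` E k) by exact: measurableI.
apply: (@le_trans _ _ (P (E 0%N) + P (\bigcup_(k in `I_N.+1) (A k `&` E k)))%E).
  have mV : measurable (\bigcup_(k in `I_N.+1) (A k `&` E k)).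
    exact: bigcup_measurable.
  apply: (@le_trans _ _ (P (E 0%N `|` \bigcup_(k in `I_N.+1) (A k `&` E k)))).
    by apply: le_measure; rewrite ?inE//; exact: measurableU. 
  exact: measureU2.
rewrite mulrDl mul1r EFinD leeD//; first exact: hq.
have msum F : (forall i, measurable (F i)) -> trivIset setT F ->
    P (\bigcup_(k in `I_N.+1) F k) = (\sum_(k < N.+1) P (F k))%E.
  by move=> mF tF; rewrite bigcup_mkord; exact: (measure_bigsetU P).
rewrite (msum _ mAE (@trivIset_setIr _ _ _ _ E tA)).
apply: (@le_trans _ _ (\sum_(k < N.+1) q%:E * P (A k))%E).
  apply: lee_sum => k _; rewrite indep 1?muleC; last by rewrite -ltnS.
  by rewrite lee_wpmul2r// hq// -ltnS.
rewrite -ge0_sume_distrr//.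
by rewrite -(msum _ mA tA) -[leRHS]mule1; apply: lee_pmul => //; rewrite ?lee_fin//; exact: probability_le1.
Qed.

End MaximalInequality.

(** * Large displacements at dyadic times *)

Section DyadicJumps.
Context {R : realType}.

Definition dyadic_point (a h : R) (m k : nat) : R := a + h * (k%:R / 2 ^+ m).

(** A jump here is a displacement from the left endpoint, not a discontinuity. Only countably many
    times are tested, so that the event is measurable. *)
Definition dyadic_jump (f : R -> R) (a h c : R) : Prop :=
  exists m k : nat, (k <= 2 ^ m)%N /\ c <= `|f (dyadic_point a h m k) - f a|.

Lemma dyadic_point0 (a h : R) m : dyadic_point a h m 0 = a.
Proof. by rewrite /dyadic_point mul0r mulr0 addr0. Qed.

Lemma dyadic_point_double (a h : R) m k :
  dyadic_point a h m.+1 (2 * k) = dyadic_point a h m k.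
Proof. by rewrite /dyadic_point exprS natrM -mulf_div divff ?mul1r. Qed.

Lemma dyadic_point_nd (a h : R) m : 0 <= h ->
  {homo dyadic_point a h m : i j / (i <= j)%N >-> i <= j}.
Proof.
by move=> h0 i j ij; rewrite lerD2l ler_wpM2l// ler_wpM2r ?ler_nat.
Qed.

Lemma dyadic_point_last (a h : R) m : dyadic_point a h m (2 ^ m) = a + h.
Proof. by rewrite /dyadic_point natrX divff ?mulr1// expf_neq0. Qed.

Context {d : measure_display} {T : measurableType d}.
Variables (P : probability T R) (phi : {measure set R -> \bar R}).
Hypothesis phi_conc : phi (~` range (fun k : int => (2 : R) ^ k)) = 0%E.
Hypothesis phi_atom : forall k : int, phi [set (2 : R) ^ k] = ((2 : R) ^ (- k))%:E.
Variable X : R -> T -> R.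
Hypothesis X_levy : levy_process P X.
Hypothesis X_char : forall t y : R, 0 <= t ->
  char_fun P (X t) y = cexp (t%:C%C * levy_exponent phi y).

Definition jump_event (a h c : R) : set T := [set w | dyadic_jump (X ^~ w) a h c].

Let level_event (a h c : R) m : set T :=
  \bigcup_(k in `I_(2 ^ m).+1)
    [set w | c <= `|X (dyadic_point a h m k) w - X (dyadic_point a h m 0) w|].

Let jump_eventE a h c : jump_event a h c = \bigcup_m level_event a h c m.
Proof.
apply/seteqP; split => [w [m [k [km ck]]]|w [m _ [k km ck]]].
  by exists m => //; exists k => //=; rewrite dyadic_point0.
by exists m, k; split => //; move: ck; rewrite /= dyadic_point0.
Qed.

Let level_event_measurable a h c m : 0 <= a -> 0 <= h -> measurable (level_event a h c m).
Proof.
move=> a0 h0; apply: bigcup_measurable => k _.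
apply/measurable_le_norm/(levy_increment_measurable X_levy); first by rewrite dyadic_point0.
by apply: (le_trans a0); rewrite -{1}(dyadic_point0 a h m) dyadic_point_nd.
Qed.

Lemma jump_event_measurable a h c : 0 <= a -> 0 <= h -> measurable (jump_event a h c).
Proof.
by move=> a0 h0; rewrite jump_eventE; apply: bigcupT_measurable => m; exact: level_event_measurable.
Qed.

(** The maximal inequality with [b = 2 / 2^n] bounds every dyadic level by the same constant. The
    grids are nested, so the events increase and continuity from below gives the bound for their
    union. *)
Lemma jump_event_le (a h : R) (n : nat) : 0 <= a -> 0 <= h ->
  (P (jump_event a h (4 / 2 ^+ n)) <= (40 * h * n.+1%:R * 2 ^+ n)%:E)%E.
Proof.
move=> a0 h0; set c := 4 / 2 ^+ n.
have ndE : nondecreasing_seq (level_event a h c).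
  apply/nondecreasing_seqP => m; apply/subsetPset => w [k km /= ck].
  exists (2 * k)%N; first by rewrite /= ltnS expnS leq_mul2l.
  by move: ck; rewrite /= dyadic_point_double !dyadic_point0.
have mE m := level_event_measurable c m a0 h0.
have cvgP : P \o level_event a h c @ \oo --> P (jump_event a h c).
  rewrite jump_eventE; apply: nondecreasing_cvg_mu => //.
  exact: bigcupT_measurable.
rewrite -(cvg_lim _ cvgP)//; apply: lime_le; first by apply/cvg_ex; eexists; exact: cvgP.
near=> m => /=.
have -> : 40 * h * n.+1%:R * 2 ^+ n = 2 * (20 * h * n.+1%:R * 2 ^+ n) :> R by ring.
rewrite /level_event (_ : c = 2 * (2 / 2 ^+ n)); last by rewrite /c; field.
apply: (levy_maximal_inequality X_levy) => //.
- by rewrite dyadic_point0.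
- by move=> i; exact: dyadic_point_nd.
- by rewrite !mulr_ge0.
move=> k km; apply: (le_trans (levy_increment_tail phi_conc phi_atom X_levy X_char n _)).
  rewrite dyadic_point_nd// andbT.
  by apply: (le_trans a0); rewrite -{1}(dyadic_point0 a h m) dyadic_point_nd.
rewrite lee_fin ler_wpM2r// ler_wpM2r// ler_wpM2l//.
rewrite dyadic_point_last lerBlDl lerD2r.
by rewrite -{1}(dyadic_point0 a h m) dyadic_point_nd.
Unshelve. all: by end_near. Qed.

End DyadicJumps.

(** * Almost sure control of the oscillations *)

Section SummableExpectation.
Context {R : realType} {d : measure_display} {T : measurableType d}.
Variable mu : {measure set T -> \bar R}.

(** The series has finite integral, hence is finite almost everywhere, and its value at [w] serves
    as the bound [K] for all terms. *)
Lemma ae_bounded_of_summable (V : nat -> T -> \bar R) (B : R) :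
  (forall n, measurable_fun setT (V n)) -> (forall n w, 0 <= V n w)%E ->
  (forall N, (\sum_(n < N) \int[mu]_w V n w <= B%:E)%E) ->
  {ae mu, forall w, exists K : R, forall n, (V n w <= K%:E)%E}.
Proof.
move=> mV V0 hB.
have S0 w : (0 <= \sum_(n <oo) V n w)%E by exact: nneseries_ge0.
have iS : mu.-integrable setT (fun w => \sum_(n <oo) V n w)%E.
  apply/integrableP; split.
    have := @ge0_emeasurable_sum _ _ _ setT V xpredT (fun k x _ _ => V0 k x) (fun k _ => mV k).
    by congr measurable_fun; apply/funext => w; apply: eq_eseriesl.
  under eq_integral do rewrite gee0_abs//.
  rewrite integral_nneseries//.
  apply: (@le_lt_trans _ _ B%:E); last exact: ltry.
  apply: lime_le.
    by apply: is_cvg_nneseries => n _ _; exact: integral_ge0.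
  by near=> N; rewrite big_mkord.
apply: filterS (integrable_ae measurableT iS) => w /(_ I) fS.
exists (fine (\sum_(n <oo) V n w)%E) => n; rewrite fineK//.
apply: le_trans (nneseries_lim_ge n.+1 _); last by move=> k _ _.
rewrite big_nat_recr//= leeDr// sume_ge0// => k _.
Unshelve. all: by end_near. Qed.

End SummableExpectation.

Section JumpCount.
Context {R : realType}.

Definition grid (n j : nat) : R := 2^-1 + j%:R / 2 ^+ n.

(** A layer-cake substitute for the sum of [min 1 oscillation]: reaching [4 / 2^m] counts [2^-m].
    Starting at [m = 0] caps a column at total weight 2, and stopping at [m = n] matches the radius
    of the balls. *)
Definition jump_count (f : R -> R) (n : nat) : R :=
  \sum_(j < (2 ^ n)%N) \sum_(m < n.+1)
    (2 ^+ m)^-1 * `[< dyadic_jump f (grid n j) (2 ^+ n)^-1 (4 / 2 ^+ m) >]%:R.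

Lemma grid_ge0 n j : 0 <= grid n j.
Proof. by rewrite /grid addr_ge0// ?divr_ge0. Qed.

Lemma telescope_inv_natr (N : nat) :
  \sum_(n < N) (n.+1%:R * n.+2%:R)^-1 = 1 - N.+1%:R^-1 :> R.
Proof.
elim: N => [|N IH]; first by rewrite big_ord0 invr1 subrr.
rewrite big_ord_recr/= IH -!natr1; have := ler0n R N => N0.
field; apply/andP; split; apply: lt0r_neq0; lra.
Qed.

Context {d : measure_display} {T : measurableType d}.
Variables (P : probability T R) (phi : {measure set R -> \bar R}).
Hypothesis phi_conc : phi (~` range (fun k : int => (2 : R) ^ k)) = 0%E.
Hypothesis phi_atom : forall k : int, phi [set (2 : R) ^ k] = ((2 : R) ^ (- k))%:E.
Variable X : R -> T -> R.
Hypothesis X_levy : levy_process P X.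
Hypothesis X_char : forall t y : R, 0 <= t ->
  char_fun P (X t) y = cexp (t%:C%C * levy_exponent phi y).

Lemma jump_count_ae : {ae P, forall w, exists2 K : R, 0 <= K &
  forall n, jump_count (X ^~ w) n <= K * n.+2%:R ^+ 4}.
Proof.
pose E n j m := jump_event X (grid n j) (2 ^+ n)^-1 (4 / 2 ^+ m).
have h0 n : 0 <= (2 ^+ n)^-1 :> R by rewrite invr_ge0 exprn_ge0.
have mE n j m : measurable (E n j m).
  by apply: (jump_event_measurable X_levy) => //; exact: grid_ge0.
(* There are [2^n] intervals and [n + 1] levels, each with expectation at most [40 (n + 1) / 2^n],
   so the count has mean at most [40 (n + 1)^2]. Division by [(n + 2)^4] leaves at most
   [40 / ((n + 1) (n + 2))], a telescoping series. *)
pose c n m : R := (2 ^+ m * n.+2%:R ^+ 4)^-1.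
have c0 n m : 0 <= c n m by rewrite invr_ge0 mulr_ge0// exprn_ge0.
pose V n w : \bar R :=
  (\sum_(j < (2 ^ n)%N) \sum_(m < n.+1) (c n m)%:E * (\1_(E n j m) w)%:E)%E.
have m1 n j m : measurable_fun setT (fun w => (c n m)%:E * (\1_(E n j m) w)%:E)%E.
  by apply: measurable_funeM; apply/measurable_EFinP; exact: measurable_indic.
have V10 n j m w : (0 <= (c n m)%:E * (\1_(E n j m) w)%:E)%E.
  by rewrite mule_ge0// lee_fin.
have mV n : measurable_fun setT (V n).
  by apply: emeasurable_sum => j; exact: emeasurable_sum.
have V0 n w : (0 <= V n w)%E.
  by rewrite sume_ge0// => j _; rewrite sume_ge0.
have VE n w : V n w = (jump_count (X ^~ w) n / n.+2%:R ^+ 4)%:E.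
  rewrite /V /jump_count mulr_suml -sumEFin; apply: eq_bigr => j _.
  rewrite mulr_suml -sumEFin; apply: eq_bigr => m _.
  rewrite -EFinM indicE /c invfM mulrAC.
  have -> // : (w \in E n j m) =
    `[< dyadic_jump (X ^~ w) (grid n j) (2 ^+ n)^-1 (4 / 2 ^+ m) >].
  by apply/idP/asboolP; rewrite inE.
have EV n : (\int[P]_w V n w <= (40 * (n.+1%:R * n.+2%:R)^-1)%:E)%E.
  rewrite ge0_integral_sum//; last 2 first.
  - by move=> j; exact: emeasurable_sum.
  - by move=> j w _; rewrite sume_ge0.
  apply: (@le_trans _ _ (\sum_(j < (2 ^ n)%N) \sum_(m < n.+1)
     (c n m * (40 * (2 ^+ n)^-1 * m.+1%:R * 2 ^+ m))%:E)%E).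
    apply: lee_sum => j _; rewrite ge0_integral_sum//.
    apply: lee_sum => m _; rewrite ge0_integralZl//; last 2 first.
    - by apply/measurable_EFinP; exact: measurable_indic.
    - by rewrite lee_fin.
    rewrite integral_indic// setIT EFinM lee_wpmul2l ?lee_fin//.
    apply: (jump_event_le phi_conc phi_atom X_levy X_char) => //.
    exact: grid_ge0.
  under eq_bigr do rewrite sumEFin; rewrite sumEFin lee_fin.
  have n2 : 0 < (2 : R) ^+ n by rewrite exprn_gt0.
  apply: (@le_trans _ _ (\sum_(j < (2 ^ n)%N) \sum_(m < n.+1)
     40 * (2 ^+ n)^-1 * n.+1%:R * (n.+2%:R ^+ 4)^-1)).
    apply: ler_sum => j _; apply: ler_sum => m _.
    rewrite /c invfM [leLHS](_ : _ = 40 * (2 ^+ n)^-1 * m.+1%:R * (n.+2%:R ^+ 4)^-1).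
      rewrite ler_wpM2r ?invr_ge0 ?exprn_ge0// ler_wpM2l ?mulr_ge0// ler_nat.
      exact: ltn_ord.
    have m2 : 0 < (2 : R) ^+ m by rewrite exprn_gt0.
    by field; rewrite !lt0r_neq0.
  rewrite !sumr_const !card_ord -mulrnA -[leLHS]mulr_natr natrM natrX.
  have a0 : 0 < n.+1%:R :> R by [].
  rewrite [leLHS](_ : _ = 40 * (n.+1%:R ^+ 2 * (n.+2%:R ^+ 4)^-1)); last first.
    by field; rewrite !lt0r_neq0.
  rewrite ler_pM2l// ler_pdivrMr ?exprn_gt0// mulrC ler_pdivlMr ?mulr_gt0//.
  have : n.+1%:R <= n.+2%:R :> R by rewrite ler_nat.
  have : 1 <= n.+1%:R :> R by rewrite ler1n.
  move: (n.+1%:R) (n.+2%:R) => x y x1 xy.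
  have -> : x ^+ 2 * (x * y) = x ^+ 3 * y by ring.
  have -> : y ^+ 4 = y ^+ 3 * y by ring.
  by rewrite ler_wpM2r ?lerXn2r// ?nnegrE; lra.
have hB N : (\sum_(n < N) \int[P]_w V n w <= 40%:E)%E.
  apply: (@le_trans _ _ (\sum_(n < N) (40 * (n.+1%:R * n.+2%:R)^-1)%:E)%E).
    by apply: lee_sum => n _; exact: EV.
  rewrite sumEFin lee_fin -mulr_sumr telescope_inv_natr.
  by rewrite -[leRHS]mulr1 ler_wpM2l// gerBl invr_ge0.
apply: filterS (ae_bounded_of_summable mV V0 hB) => w [K hK].
have hK' n : jump_count (X ^~ w) n <= K * n.+2%:R ^+ 4.
  by have := hK n; rewrite VE lee_fin ler_pdivrMr ?exprn_gt0.
by exists K => //; rewrite -lee_fin; exact: le_trans (V0 0%N w) (hK 0%N).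
Qed.

End JumpCount.

(** * Boundedness of càdlàg paths and passage from dyadic to all times *)

Section CadlagPaths.
Context {R : realType}.
Implicit Types (f : R -> R) (a b h t : R).

Lemma at_right_dist_lt f t (l e : R) : f s @[s --> t^'+] --> l -> 0 < e ->
  exists2 r : R, 0 < r & forall s : R, t < s < t + r -> `|l - f s| < e.
Proof.
move=> /cvgrPdist_lt/[apply]; rewrite near_withinE => /nbhs_ballP[r /= r0 H].
exists r => // s /andP[ts sr]; apply: H => //.
by rewrite /ball/= distrC ger0_norm ?subr_ge0 ?(ltW ts)//; rewrite ltrBlDl.
Qed.

Lemma at_left_dist_lt f t (l e : R) : f s @[s --> t^'-] --> l -> 0 < e ->
  exists2 r : R, 0 < r & forall s : R, t - r < s < t -> `|l - f s| < e.
Proof.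
move=> /cvgrPdist_lt/[apply]; rewrite near_withinE => /nbhs_ballP[r /= r0 H].
exists r => // s /andP[ts sr]; apply: H => //.
by rewrite /ball/= ger0_norm ?subr_ge0 ?(ltW sr)//; rewrite ltrBlDl -ltrBlDr.
Qed.

Lemma cadlag_locally_bounded f t : cadlag f -> 0 < t ->
  exists2 r : R, 0 < r & exists M : R, forall s : R, t - r < s < t + r -> `|f s| <= M.
Proof.
move=> [fr fl] t0.
have [r1 r10 H1] := at_right_dist_lt (fr t (ltW t0)) ltr01.
have /cvg_ex[l hl] := fl t t0.
have [r2 r20 H2] := at_left_dist_lt hl ltr01.
exists (Num.min r1 r2); first by rewrite lt_min r10.
exists (1 + `|f t| + `|l|) => s.
have tri (x : R) : `|f s| <= `|x - f s| + `|x|.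
  by rewrite -{1}(subKr x (f s)) (le_trans (ler_normB _ _))// addrC.
have := normr_ge0 (f t); have := normr_ge0 l.
have := ge_min r1 r1 r2; rewrite lexx/= => m1.
have := ge_min r2 r1 r2; rewrite lexx orbT/= => m2.
move=> l0 ft0 /andP[s1 s2]; have [st|st|->] := ltgtP s t.
- have := tri l; have := H2 s; rewrite st andbT => /(_ _)/ltW; move=> h h'.
  have := h ltac:(lra); lra.
- have := tri (f t); have := H1 s; rewrite st/= => /(_ _)/ltW; move=> h h'.
  have := h ltac:(lra); lra.
- lra.
Qed.

(** Continuation argument: local boundedness at the supremum of the [x] with [f] bounded on [[a, x]]
    would push it further, unless it is [b]. The assumption [0 < a] provides the left limits. *)
Lemma cadlag_bounded f a b : cadlag f -> 0 < a -> a <= b ->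
  exists M : R, forall t : R, a <= t <= b -> `|f t| <= M.
Proof.
move=> cf a0 ab.
pose S := [set x : R | a <= x <= b /\ exists M : R, forall t : R, a <= t <= x -> `|f t| <= M].
have Sa : S a.
  split; first by rewrite lexx.
  by exists `|f a| => t; rewrite -eq_le => /eqP ->.
have hS : has_sup S by split; [exists a|exists b => x [/andP[]]].
have [s sub adh] : exists2 s : R, ubound S s &
    forall e : R, 0 < e -> exists2 x : R, S x & s - e < x.
  by exists (sup S); [exact: sup_upper_bound|move=> e e0; exact: sup_adherent].
have sa : a <= s by exact: sub.
have [r r0 [M HM]] := cadlag_locally_bounded cf (lt_le_trans a0 sa).
have [x [/andP[ax xb] [M' HM']] sx] := adh _ r0.
pose y := Num.min b (s + r / 2).
have Sy : S y.
  split; first by rewrite le_min ab ge_min lexx/= andbT; lra.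
  exists (Num.max M M') => t /andP[at_ ty]; rewrite le_max.
  have [tx|xt] := leP t x; first by rewrite HM' ?at_ ?orbT.
  have : y <= s + r / 2 by rewrite ge_min lexx orbT.
  by move=> /(le_trans ty) tr; rewrite HM//; apply/andP; split; lra.
have ys : y <= s by exact: sub.
have yb : y = b.
  rewrite /y min_l// leNgt; apply/negP => h.
  by move: ys; rewrite /y min_r ?(ltW h)//; lra.
by move: Sy; rewrite yb => -[_].
Qed.

(** A displacement above [c] at [t] persists at dyadic points slightly to the right, by
    right-continuity. The end [a + h] has no such points in the interval, but is itself point 1 of
    level 0. *)
Lemma no_dyadic_jump_le f a h (c : R) : cadlag f -> 0 <= a -> 0 < h ->
  ~ dyadic_jump f a h c -> forall t : R, a <= t <= a + h -> `|f t - f a| <= c.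
Proof.
move=> [fr _] a0 h0 nj t /andP[at_ th]; rewrite leNgt; apply/negP => ct.
have [tl|] := ltP t (a + h); last first.
  move=> ht; have tE : t = a + h by apply/eqP; rewrite eq_le th.
  apply: nj; exists 0%N, 1%N; split => //.
  by rewrite /dyadic_point expr0 divr1 mulr1 -tE ltW.
have t0 : 0 <= t by lra.
have cp : 0 < `|f t - f a| - c by rewrite subr_gt0.
have [r r0 Hr] := at_right_dist_lt (fr t t0) cp.
have [m hm] : exists m : nat, h / 2 ^+ m < r.
  pose m := Num.truncn (h / r); exists m.
  rewrite ltr_pdivrMr ?exprn_gt0// mulrC -ltr_pdivrMr//.
  apply: (lt_le_trans (truncnS_gt _)); rewrite -natrX ler_nat.
  exact: ltn_expl.
have p2 : 0 < (2 : R) ^+ m by rewrite exprn_gt0.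
(* The first point of level [m] strictly after [t]; it lies within [h / 2^m < r] of [t]. *)
pose k := (Num.truncn ((t - a) * 2 ^+ m / h)).+1.
have x0 : 0 <= (t - a) * 2 ^+ m / h.
  by rewrite divr_ge0 ?mulr_ge0 ?subr_ge0// ltW.
have /andP[k1 k2] := truncn_itv x0.
have kE : (k%:R : R) = (Num.truncn ((t - a) * 2 ^+ m / h))%:R + 1 by rewrite /k natr1.
have lb : t < dyadic_point a h m k.
  have : t - a < k%:R * h / 2 ^+ m by rewrite ltr_pdivlMr// -ltr_pdivrMr.
  by rewrite /dyadic_point ltrBlDl [k%:R * h]mulrC mulrA.
have ub : dyadic_point a h m k <= t + h / 2 ^+ m.
  have : (k%:R - 1) * h / 2 ^+ m <= t - a.
    by rewrite ler_pdivrMr// -ler_pdivlMr// kE addrK.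
  rewrite /dyadic_point lerBrDl => /(lerD (lexx (h / 2 ^+ m))).
  by congr (_ <= _); ring.
apply: nj; exists m, k; split.
  rewrite /k -(ltr_nat R) natrX; apply: (le_lt_trans k1).
  by rewrite ltr_pdivrMr// mulrC ltr_pM2l//; lra.
have := Hr (dyadic_point a h m k); rewrite lb => /(_ _).
move=> /(_ ltac:(lra)) hh.
have := ler_normD (f t - f (dyadic_point a h m k)) (f (dyadic_point a h m k) - f a).
rewrite addrA subrK; lra.
Qed.

End CadlagPaths.

(** * Oscillation of the path and of its rescaling on one interval *)

Section GraphCovering.
Context {R : realType}.
Implicit Types (f : R -> R) (C M : R).

Lemma coverable_seq (d : nat) (F : set 'rV[R]_d) (delta : R) (s : seq 'rV[R]_d) :
  (forall x, F x -> exists2 c, c \in s & euclidean_closed_ball c delta x) ->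
  coverable F delta (size s).
Proof.
move=> Fs; exists (fun i => nth 0 s i) => x /Fs[c cs cx].
have i : (index c s < size s)%N by rewrite index_mem.
by exists (Ordinal i) => //=; rewrite nth_index.
Qed.

Let pow2B (m n : nat) : (m <= n)%N -> (2 : R) ^+ (n - m) = 2 ^+ n / 2 ^+ m.
Proof. by move=> mn; rewrite expfB_cond// pnatr_eq0. Qed.

(** This is [2^n] times the [j]-th summand of [jump_count], kept as a natural number because it
    fixes the number of balls stacked over the interval. *)
Definition interval_jumps f (n j : nat) : nat :=
  (\sum_(m < n.+1) 2 ^ (n - m) *
     `[< dyadic_jump f (grid n j) (2 ^+ n)^-1 (4 / 2 ^+ m) >])%N.

Lemma sum_interval_jumps f n :
  (\sum_(j < (2 ^ n)%N) interval_jumps f n j)%N%:R = 2 ^+ n * jump_count f n :> R.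
Proof.
rewrite /jump_count natr_sum mulr_sumr; apply: eq_bigr => j _.
rewrite natr_sum mulr_sumr; apply: eq_bigr => m _.
rewrite natrM mulrA natrX; congr (_ * _).
by rewrite pow2B// -ltnS.
Qed.

(* If [m] is the first level with a jump then [f] moves by at most 8 / 2^m, and
   level [m] alone contributes 2^(n-m) to [interval_jumps]. *)
Lemma oscillation_le f C n j t : cadlag f ->
  8 <= C -> (forall s : R, 2^-1 <= s <= 1 -> 2 * `|f s| <= C) ->
  grid n j <= t <= grid n j + (2 ^+ n)^-1 -> t <= 1 ->
  `|f t - f (grid n j)| <= C * (2 ^+ n)^-1 * (interval_jumps f n j).+1%:R.
Proof.
move=> cf C8 hM /andP[at_ th] t1.
set a := grid n j; set h := (2 ^+ n)^-1.
have a2 : 2^-1 <= a by rewrite /a /grid lerDl divr_ge0.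
have h0 : 0 < h by rewrite invr_gt0 exprn_gt0.
pose J m := dyadic_jump f a h (4 / 2 ^+ m).
have noJ m : ~ J m -> `|f t - f a| <= 4 / 2 ^+ m.
  move=> nJ; apply: (no_dyadic_jump_le cf _ h0 nJ); last by rewrite at_ th.
  by apply: le_trans a2; rewrite invr_ge0.
have jge m : (m <= n)%N -> J m -> (2 ^ (n - m) <= interval_jumps f n j)%N.
  move=> mn Jm; have mn1 : (m < n.+1)%N by [].
  rewrite /interval_jumps (bigD1 (Ordinal mn1))//=.
  by rewrite -/a -/h asboolT// muln1 leq_addr.
set s := interval_jumps f n j in jge *.
have Ch : 0 < C * h by rewrite mulr_gt0//; lra.
(* If no level up to [n] has a jump, level [n] bounds the displacement by [4 / 2^n]; the [.+1] in
   the claim pays for this case. *)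
have [[m [mn Jm]]|noj] := pselect (exists m, (m <= n)%N /\ J m); last first.
  have nJn : ~ J n by move=> Jn; apply: noj; exists n.
  apply: (le_trans (noJ _ nJn)); rewrite -/h.
  apply: (@le_trans _ _ (C * h * 1)); last by rewrite ler_pM2l// ler1n.
  by rewrite mulr1 ler_pM2r//; lra.
have [k kn [Jk kmin]] : exists2 k, (k <= n)%N & J k /\ forall i, (i < k)%N -> ~ J i.
  have ex : exists i, `[< J i >] by exists m; apply/asboolP.
  case: (ex_minnP ex) => k /asboolP Jk kmin; exists k.
    by apply: leq_trans mn; apply: kmin; apply/asboolP.
  by split => // i ik /asboolP/kmin; rewrite leqNgt ik.
have hk : (2 ^+ k)^-1 <= h * s.+1%:R.
  have : (2 : R) ^+ (n - k) <= s.+1%:R.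
    by rewrite -natrX ler_nat; exact: leq_trans (jge k kn Jk) (leqnSn _).
  move=> /(ler_wpM2l (ltW h0)) hs; apply: le_trans hs.
  by rewrite /h pow2B// mulrA mulVf ?mul1r// expf_neq0.
(* At [k = 0] no coarser level is available, and the bound [2 |f| <= C] on [1/2, 1] replaces it. *)
rewrite -mulrA; case: k kn Jk kmin hk => [|k] kn Jk kmin hk.
  apply: (@le_trans _ _ C).
    apply: (le_trans (ler_normB _ _)).
    have h1 := hM t; have h2 := hM a.
    rewrite (le_trans a2)//= in h1; rewrite a2 (le_trans at_ t1)/= in h2.
    have := h1 t1; have := h2 erefl; lra.
  rewrite -[leLHS]mulr1 ler_wpM2l//; first lra.
  by apply: le_trans hk; rewrite expr0 invr1.
apply: (le_trans (noJ _ (kmin k (ltnSn k)))).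
apply: (@le_trans _ _ (8 * (2 ^+ k.+1)^-1)).
  rewrite exprS invfM mulrA; rewrite ler_wpM2r ?invr_ge0 ?exprn_ge0//; lra.
by apply: ler_pM => //; rewrite invr_ge0 exprn_ge0.
Qed.

Lemma log2_dist_le (a t : R) : 2^-1 <= a -> a <= t ->
  `|log2 t - log2 a| <= 2 / ln 2 * (t - a).
Proof.
move=> a2 at_; have a0 : 0 < a by apply: lt_le_trans a2; rewrite invr_gt0.
have t0 : 0 < t by exact: lt_le_trans at_.
have l2 : 0 < ln (2 : R) by rewrite ln_gt0// ltr1n.
rewrite /log2 -mulrBl -ln_div ?posrE// normrM normfV (gtr0_norm l2).
rewrite [leRHS]mulrAC; apply: ler_wpM2r; first by rewrite invr_ge0 ltW.
have ta1 : 1 <= t / a by rewrite ler_pdivlMr// mul1r.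
rewrite ger0_norm ?ln_ge0//.
have -> : t / a = 1 + (t / a - 1) by rewrite addrC subrK.
have lb : -1 < t / a - 1 by lra.
apply: (le_trans (le_ln1Dx lb)).
rewrite [leLHS](_ : _ = a^-1 * (t - a)); last by field; exact: lt0r_neq0.
rewrite ler_wpM2r ?subr_ge0// invf_ple ?posrE//.
Qed.

Definition rescaled f (t : R) : R := t^-1 * (f t - t * log2 t).

Lemma rescaledE f t : 0 < t -> rescaled f t = t^-1 * f t - log2 t.
Proof. by move=> t0; rewrite /rescaled mulrBr mulKf// lt0r_neq0. Qed.

(** On [1/2, oo) the factor [1/t] is at most 2 and 4-Lipschitz; with [|f a| <= C / 2] this gives
    [2 C]. The term [2 / ln 2] is the Lipschitz constant of [log2] there. *)
Lemma rescaled_dist_le f C (a t : R) : 2^-1 <= a -> a <= t -> 2 * `|f a| <= C ->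
  `|rescaled f t - rescaled f a| <=
    2 * `|f t - f a| + (2 * C + 2 / ln 2) * (t - a).
Proof.
move=> a2 at_ fC; have a0 : 0 < a by apply: lt_le_trans a2; rewrite invr_gt0.
have t0 : 0 < t by exact: lt_le_trans at_.
have t2 : t^-1 <= 2 by rewrite invf_ple ?posrE// (le_trans a2).
have i2 : a^-1 <= 2 by rewrite invf_ple ?posrE.
have ti : 0 < t^-1 by rewrite invr_gt0.
have ai : 0 < a^-1 by rewrite invr_gt0.
rewrite !rescaledE//.
have -> : t^-1 * f t - log2 t - (a^-1 * f a - log2 a) =
   t^-1 * (f t - f a) - (f a * (t^-1 * a^-1 * (t - a)) + (log2 t - log2 a)).
  by field; rewrite !lt0r_neq0.
apply: (le_trans (ler_normB _ _)); apply: lerD.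
  by rewrite normrM gtr0_norm// ler_wpM2r.
apply: (le_trans (ler_normD _ _)); rewrite mulrDl; apply: lerD; last exact: log2_dist_le.
have ta : 0 <= t - a by rewrite subr_ge0.
have tta : 0 <= t^-1 * a^-1 * (t - a) by rewrite !mulr_ge0 ?(ltW ti) ?(ltW ai).
rewrite normrM (ger0_norm tta).
rewrite mulrA ler_wpM2r//.
have : t^-1 * a^-1 <= 2 * 2 by apply: ler_pM => //; exact: ltW.
move=> /(ler_wpM2l (normr_ge0 (f a)))/le_trans; apply; lra.
Qed.

End GraphCovering.

(** * From covering estimates at dyadic radii to the dimension *)

Section BoxDimensionOne.
Context {R : realType}.
Implicit Types (F : set 'rV[R]_2) (f : R -> R).

Definition point2 (x y : R) : 'rV[R]_2 := \row_(i < 2) (if i == 0 then x else y).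

Lemma euclidean_closed_ball2 (c x : 'rV[R]_2) (r : R) :
  euclidean_closed_ball c r x =
  (Num.sqrt ((x 0 0 - c 0 0) ^+ 2 + (x 0 1 - c 0 1) ^+ 2) <= r) :> Prop.
Proof.
rewrite /euclidean_closed_ball/= big_ord_recl big_ord1.
by have -> : lift ord0 ord0 = 1 :> 'I_2 by apply/val_inj.
Qed.

Lemma point2E x y : (point2 x y 0 0 = x) * (point2 x y 0 1 = y).
Proof. by rewrite /point2 !mxE. Qed.

Lemma mem_euclidean_closed_ball2 (c x : 'rV[R]_2) (p q : R) :
  `|x 0 0 - c 0 0| <= p -> `|x 0 1 - c 0 1| <= q ->
  euclidean_closed_ball c (p + q) x.
Proof.
move=> hp hq; have p0 := le_trans (normr_ge0 _) hp; have q0 := le_trans (normr_ge0 _) hq.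
rewrite euclidean_closed_ball2 -[leRHS]ger0_norm ?addr_ge0// -sqrtr_sqr.
rewrite ler_sqrt ?sqr_ge0//.
have := lerXn2r 2 _ _ hp; rewrite !nnegrE normr_ge0 p0 real_normK ?num_real// => /(_ isT isT) h1.
have := lerXn2r 2 _ _ hq; rewrite !nnegrE normr_ge0 q0 real_normK ?num_real// => /(_ isT isT) h2.
apply: (le_trans (lerD h1 h2)); rewrite sqrrD.
by rewrite addrAC lerDl mulrn_wge0// mulr_ge0.
Qed.

Lemma euclidean_closed_ball2_fst (c x : 'rV[R]_2) (r : R) :
  euclidean_closed_ball c r x -> `|x 0 0 - c 0 0| <= r.
Proof.
rewrite euclidean_closed_ball2; apply: le_trans.
by rewrite -sqrtr_sqr ler_sqrt ?lerDl ?sqr_ge0// addr_ge0 ?sqr_ge0.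
Qed.

(** One cover suffices for a least one to exist, so that [xget] does not return its default 0. *)
Lemma covering_number_min (d : nat) (F : set 'rV[R]_d) (delta : R) (n : nat) :
  coverable F delta n ->
  coverable F delta (covering_number F delta) /\ (covering_number F delta <= n)%N.
Proof.
move=> Fn; have ex : exists m, `[< coverable F delta m >] by exists n; exact/asboolP.
have : (exists m, coverable F delta m /\
    forall k, coverable F delta k -> (m <= k)%N).
  case: (ex_minnP ex) => m /asboolP Fm mmin; exists m; split => // k Fk.
  by apply: mmin; exact/asboolP.
by move=> /(xgetPex 0%N)[h1 h2]; split => //; exact: h2.
Qed.

Lemma coverable_le (d : nat) (F : set 'rV[R]_d) (delta delta' : R) (n : nat) :
  delta <= delta' -> coverable F delta n -> coverable F delta' n.
Proof.
move=> dd [c Fc]; exists c => x /Fc[i _ hi]; exists i => //.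
exact: le_trans hi dd.
Qed.

(* Projecting the balls to the time axis covers [1/2, 1] by intervals of length
   [2 delta]. *)
Lemma coverable_graph_ge (f : R -> R) (delta : R) (n : nat) : 0 <= delta ->
  coverable (graph_on `[2^-1, 1] f) delta n -> 2^-1 <= n%:R * (2 * delta).
Proof.
move=> d0 [c Fc].
(* Centres are reindexed by [nat] for Boole's inequality; for [k < n] the default 0 is not
   reached. *)
pose c0 (k : nat) : R := if insub k is Some i then c i 0 0 else 0.
pose I (k : nat) := [set` `[c0 k - delta, c0 k + delta]] : set R.
pose A := [set` `[2^-1, 1]] : set R.
have cov : A `<=` \big[setU/set0]_(k < n) I k.
  move=> t ht.
  have /Fc[i _ hi] : graph_on `[2^-1, 1] f (point2 t (f t)) by exists t.
  rewrite -bigcup_mkord; exists i => /=; first exact: ltn_ord.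
  have := euclidean_closed_ball2_fst hi; rewrite !point2E ler_norml /I /c0 valK/= in_itv/=.
  by move=> /andP[h1 h2]; apply/andP; split; lra.
have lI k : (lebesgue_measure (I k) <= (2 * delta)%:E)%E.
  rewrite lebesgue_measure_itv/= lte_fin; case: ifPn => _; last by rewrite lee_fin mulr_ge0.
  by rewrite -EFinB lee_fin; lra.
have : (lebesgue_measure A <= (n%:R * (2 * delta))%:E)%E.
  have mI k : measurable (I k) by exact: measurable_itv.
  apply: (@le_trans _ _ (\sum_(k < n) lebesgue_measure (I k))%E).
    apply: (@le_trans _ _ (lebesgue_measure (\big[setU/set0]_(k < n) I k))).
      apply: le_measure; rewrite ?inE//; first exact: measurable_itv.
      by apply: bigsetU_measurable => k _; exact: mI.
    exact: (@Boole_inequality _ _ _ lebesgue_measure I n (fun k _ => mI k)).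
  apply: (@le_trans _ _ (\sum_(k < n) (2 * delta)%:E)%E).
    by apply: lee_sum => k _; exact: lI.
  by rewrite sumEFin lee_fin sumr_const card_ord [leRHS]mulr_natl.
rewrite lebesgue_measure_itv/= lte_fin invf_lt1 ?ltr1n//.
by rewrite -EFinB lee_fin; lra.
Qed.

(** Makes the logarithm of the polynomial factor O(sqrt L) for [L = - ln delta], hence negligible
    after division by [L]. *)
Lemma ln_le_sqrt (x : R) : 0 < x -> ln x <= 2 * Num.sqrt x.
Proof.
move=> x0; have s0 : 0 < Num.sqrt x by rewrite sqrtr_gt0.
rewrite -{1}(sqr_sqrtr (ltW x0)) expr2 lnM ?posrE//.
have := ltW (ln_sublinear s0); lra.
Qed.

(** Transfers covers of radius [2 / 2^n] to an arbitrary [delta] at the price of a constant factor: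
    the least [n] with [2 / delta <= 2^n] overshoots by less than a factor 2. *)
Lemma dyadic_scale (delta : R) : 0 < delta < 1 ->
  exists2 n : nat, 2 / 2 ^+ n <= delta & 2 ^+ n <= 4 / delta.
Proof.
move=> /andP[d0 d1].
have pw n : 0 < (2 : R) ^+ n by rewrite exprn_gt0.
have ex : exists n : nat, 2 / delta <= 2 ^+ n.
  exists (Num.truncn (2 / delta)).+1; apply: ltW.
  apply: (lt_le_trans (truncnS_gt _)); rewrite -natrX ler_nat.
  exact/ltnW/ltn_expl.
case: (ex_minnP ex) => n hn nmin; exists n.
  by rewrite ler_pdivrMr// mulrC -ler_pdivrMr.
case: n hn nmin => [|n] hn nmin.
  by rewrite ler_pdivlMr// expr0 mul1r; lra.
have : 2 ^+ n < 2 / delta.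
  by rewrite ltNge; apply/negP => /nmin; rewrite ltnn.
by rewrite exprS; lra.
Qed.

Lemma has_box_dimension_one (F : set 'rV[R]_2) (C : R) : euclidean_bounded F ->
  0 < C ->
  (forall (delta : R) n, 0 < delta -> coverable F delta n -> 2^-1 <= n%:R * (2 * delta)) ->
  (forall n, exists2 N, coverable F (2 / 2 ^+ n) N & N%:R <= C * n.+2%:R ^+ 4 * 2 ^+ n) ->
  has_box_dimension F 1.
Proof.
move=> bF C0 lower upper; split => //.
have l2 : 0 < ln (2 : R) by rewrite ln_gt0// ltr1n.
(* From [2^n <= 4 / delta] follows [n + 2 <= 4 + L / ln 2], which is at most [kappa * L] since
   [L >= 1]. *)
pose kappa : R := (ln 2)^-1 + 4.
have k0 : 0 < kappa by rewrite addr_gt0// invr_gt0.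
(* The lower bound loses [ln 4], the upper one [ln (4 C) + 4 ln (n + 2)], and the last term is at
   most [8 sqrt(kappa L)]. *)
pose c := ln 4 + `|ln (4 * C)| + 8 * Num.sqrt kappa.
have c0 : 0 < c.
  by rewrite ltr_wpDl ?addr_ge0 ?ln_ge0 ?ler1n// mulr_gt0// sqrtr_gt0.
have key (delta : R) : 0 < delta -> delta < expR (-1) ->
    `|1 - ln (covering_number F delta)%:R / - ln delta| <= c / Num.sqrt (- ln delta).
  move=> d0 d1; set L := - ln delta.
  have L1 : 1 <= L.
    rewrite /L lerNr -[leRHS](@expRK R); rewrite ler_ln ?posrE ?expR_gt0//.
    exact: ltW.
  have dlt1 : delta < 1 by apply: (lt_trans d1); rewrite expR_lt1 ltrN10.
  have [|n hn1 hn2] := @dyadic_scale delta; first by rewrite d0.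
  have [N cN hN] := upper n.
  have [cov le_cov] := covering_number_min (coverable_le hn1 cN).
  have lowN := lower _ _ d0 cov.
  set Nd := covering_number F delta in cov le_cov lowN *.
  have Nd0 : 0 < Nd%:R :> R.
    rewrite ltNge; apply/negP => h; move: lowN.
    have -> : Nd%:R = 0 :> R by apply/eqP; rewrite eq_le h ler0n.
    by rewrite mul0r leNgt invr_gt0 ltr0n.
  have low : L - ln 4 <= ln Nd%:R.
    rewrite /L -[- ln delta]lnV ?posrE// -ln_div ?posrE ?invr_gt0//.
    rewrite ler_ln ?posrE ?divr_gt0 ?invr_gt0//.
    rewrite ler_pdivrMr// -[leLHS]mul1r ler_pdivrMr//.
    by move: lowN; lra.
  have n4 : 0 < n.+2%:R ^+ 4 :> R by rewrite exprn_gt0.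
  have up : ln Nd%:R <= ln (4 * C) + 4 * ln n.+2%:R + L.
    have -> : ln (4 * C) + 4 * ln n.+2%:R + L = ln (4 * C * n.+2%:R ^+ 4 / delta).
      rewrite ln_div ?posrE ?mulr_gt0// [ln (_ * _ ^+ 4)]lnM ?posrE ?mulr_gt0// lnXn//.
      by rewrite [4 * ln _]mulr_natl.
    rewrite ler_ln ?posrE ?divr_gt0 ?mulr_gt0//.
    apply: (@le_trans _ _ N%:R); first by rewrite ler_nat.
    apply: (le_trans hN).
    rewrite [leRHS](_ : _ = C * n.+2%:R ^+ 4 * (4 / delta)); last by ring.
    by rewrite ler_pM2l// mulr_gt0.
  have n_le : n.+2%:R <= kappa * L.
    have : n%:R * ln 2 <= ln 4 + L.
      rewrite mulr_natl -lnXn// /L -ln_div ?posrE//.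
      by rewrite ler_ln ?posrE ?divr_gt0 ?exprn_gt0.
    rewrite (_ : ln 4 = 2 * ln 2); last first.
      by rewrite (_ : 4 = 2 ^+ 2 :> R) ?lnXn// ?mulr_natl//; ring.
    rewrite -ler_pdivlMr// mulrDl mulfK ?lt0r_neq0// => h.
    by rewrite -2!natr1 /kappa mulrDl [_^-1 * L]mulrC; lra.
  have sL : 0 < Num.sqrt L by rewrite sqrtr_gt0; lra.
  have sL1 : 1 <= Num.sqrt L by rewrite -[leLHS]sqrtr1 ler_sqrt//; lra.
  have LE : L = Num.sqrt L * Num.sqrt L by rewrite -expr2 sqr_sqrtr//; lra.
  have lnn : ln n.+2%:R <= 2 * (Num.sqrt kappa * Num.sqrt L).
    apply: (le_trans (ln_le_sqrt _)) => //; rewrite ler_wpM2l//.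
    rewrite -sqrtrM ?(ltW k0)// ler_sqrt// mulr_ge0 ?(ltW k0)//; lra.
  have L0 : 0 < L by lra.
  have -> : 1 - ln Nd%:R / L = (L - ln Nd%:R) / L.
    by rewrite mulrBl divff// lt0r_neq0.
  rewrite normrM normfV (gtr0_norm L0) ler_pdivrMr//.
  rewrite [X in _ <= _ * X]LE mulrA divfK ?lt0r_neq0//.
  have ln4 : 0 <= ln (4 : R) by rewrite ln_ge0// ler1n.
  have a0 := normr_ge0 (ln (4 * C)).
  have ab : ln (4 * C) <= `|ln (4 * C)| by exact: ler_norm.
  have b1 : ln 4 <= ln 4 * Num.sqrt L by rewrite ler_peMr.
  have b2 : `|ln (4 * C)| <= `|ln (4 * C)| * Num.sqrt L by rewrite ler_peMr.
  have b3 : 0 <= Num.sqrt kappa * Num.sqrt L by rewrite mulr_ge0 ?sqrtr_ge0.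
  have -> : c * Num.sqrt L = ln 4 * Num.sqrt L + `|ln (4 * C)| * Num.sqrt L +
    8 * (Num.sqrt kappa * Num.sqrt L) by rewrite /c; ring.
  move: low up lnn ab b1 b2 b3 a0 ln4; clear; move: (ln Nd%:R) (ln n.+2%:R) L.
  move: (ln 4) (ln (4 * C)) => l4 l4C lN ln L.
  move: `|l4C| (`|l4C| * _) (l4 * _) (Num.sqrt kappa * _) => s r q p.
  by move=> *; rewrite ler_norml; apply/andP; split; lra.
apply/cvgrPdist_lt => e e0; near=> delta.
have d0 : 0 < delta by near: delta; exact: nbhs_right_gt.
have d1 : delta < expR (-1) by near: delta; apply: nbhs_right_lt; exact: expR_gt0.
have d2 : delta < expR (- (c / e) ^+ 2).
  by near: delta; apply: nbhs_right_lt; exact: expR_gt0.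
apply: (le_lt_trans (key _ d0 d1)).
have ce : 0 < c / e by rewrite divr_gt0.
have hL : (c / e) ^+ 2 < - ln delta.
  rewrite ltrNr -[ltRHS](@expRK R); rewrite ltr_ln ?posrE ?expR_gt0//.
have : c / e < Num.sqrt (- ln delta).
  rewrite -[ltLHS](gtr0_norm ce) -sqrtr_sqr ltr_sqrt//.
  exact: le_lt_trans (sqr_ge0 _) hL.
rewrite ltr_pdivrMr// => h; rewrite ltr_pdivrMr 1?mulrC//.
rewrite sqrtr_gt0; exact: le_lt_trans (sqr_ge0 _) hL.
Unshelve. all: by end_near. Qed.

End BoxDimensionOne.

(** * Explicit covers of the rescaled graph, and the theorem *)

Section RescaledGraph.
Context {R : realType}.
Variables (f : R -> R) (C : R).
Hypothesis f_cadlag : cadlag f.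
Hypothesis C_ge8 : 8 <= C.
Hypothesis f_bounded : forall s : R, 2^-1 <= s <= 1 -> 2 * `|f s| <= C.

Let C_ge0 : 0 <= C.
Proof. exact: le_trans C_ge8. Qed.

(** Inserting [oscillation_le] into [rescaled_dist_le] gives [2 C] from the path and
    [2 C + 2 / ln 2] from the rescaling. *)
Let B : R := 4 * C + 2 / ln 2.

Let B_ge1 : 1 <= B.
Proof.
have l2 : 0 <= 2 / ln (2 : R) by rewrite divr_ge0// ln_ge0// ler1n.
by have := C_ge8; rewrite /B; move: (2 / _) l2 => q; lra.
Qed.

Lemma rescaled_graph_bounded :
  euclidean_bounded (graph_on `[2^-1, 1] (rescaled f)).
Proof.
exists (1 + (`|rescaled f 2^-1| + (2 * (2 * C) + B))) => _ [t /= + <-].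
rewrite in_itv/= => /andP[t2 t1].
have t0 : 0 <= t by apply: le_trans t2; rewrite invr_ge0.
have l2 : 0 <= 2 / ln (2 : R) by rewrite divr_ge0// ln_ge0// ler1n.
apply: mem_euclidean_closed_ball2; rewrite !mxE subr0//=; first by rewrite ger0_norm.
have f2 : 2 * `|f 2^-1| <= C by apply: f_bounded; rewrite lexx/=; lra.
have ft : 2 * `|f t| <= C by apply: f_bounded; rewrite t2.
have d1 := rescaled_dist_le (lexx (2^-1)) t2 f2.
have d2 := ler_normB (f t) (f 2^-1).
have := ler_normD (rescaled f 2^-1) (rescaled f t - rescaled f 2^-1); rewrite subrKC => d3.
have d4 : (2 * C + 2 / ln 2) * (t - 2^-1) <= (2 * C + 2 / ln 2) * 1.
  apply: ler_wpM2l; first by rewrite addr_ge0// mulr_ge0.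
  by rewrite lerBlDr; apply: (le_trans t1); rewrite lerDl.
have C8 := C_ge8; move: d1 d4 l2; rewrite /B mulr1; move: (2 / _) => q d1 d4 q0; lra.
Qed.

Variables (n : nat) (K : R).
Hypothesis K_ge0 : 0 <= K.
Hypothesis jumps_le : jump_count f n <= K * n.+2%:R ^+ 4.

(** Over the [j]-th interval the graph stays within [h * k j] of its starting height, so
    [2 * k j + 1] centres at vertical spacing [h] leave offsets of at most [h] in each coordinate.
    This explains the radius [h + h]. *)
Lemma rescaled_graph_coverable :
  exists2 N, coverable (graph_on `[2^-1, 1] (rescaled f)) (2 / 2 ^+ n) N &
    N%:R <= (2 * (B + 1) * (1 + K) + 1) * n.+2%:R ^+ 4 * 2 ^+ n.
Proof.
have n2 : 0 < (2 : R) ^+ n by rewrite exprn_gt0.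
pose h : R := (2 ^+ n)^-1; have h0 : 0 < h by rewrite invr_gt0.
pose A := (Num.truncn B).+1.
have BA : B <= A%:R by apply: ltW; exact: truncnS_gt.
have AB : A%:R <= B + 1.
  have /andP[+ _] : (Num.truncn B)%:R <= B < (Num.truncn B).+1%:R.
    by apply: truncn_itv; exact: le_trans B_ge1.
  by rewrite /A -natr1; lra.
pose k j := (A * (interval_jumps f n j).+1)%N.
pose center j i := point2 (grid n j) (rescaled f (grid n j) + h * (i%:R - (k j)%:R)).
pose s := [seq center j i | j <- iota 0 (2 ^ n), i <- iota 0 (2 * k j).+1].
have size_s : size s = (\sum_(j < 2 ^ n) (2 * k j).+1)%N.
  rewrite /s size_allpairs_dep sumnE big_map.
  rewrite -(big_mkord xpredT (fun j => (2 * k j).+1)) /index_iota subn0.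
  by apply: eq_bigr => j _; rewrite size_iota.
exists (size s).
  apply: coverable_seq => _ [t /= + <-]; rewrite in_itv/= => /andP[t2 t1].
  have x0 : 0 <= (t - 2^-1) * 2 ^+ n by rewrite mulr_ge0 ?subr_ge0// ltW.
  have /andP[j1 j2] := truncn_itv x0.
  set j := Num.truncn _ in j1 j2.
  (* The [2^n] intervals reach beyond 1, so [t = 1] falls into one of them without special
     treatment. *)
  have jn : (j < 2 ^ n)%N.
    rewrite -(ltr_nat R) natrX; apply: (le_lt_trans j1).
    by rewrite -[ltRHS]mul1r ltr_pM2r//; lra.
  have at_ : grid n j <= t.
    by rewrite /grid -lerBrDl ler_pdivrMr.
  have th : t <= grid n j + h.
    have : t - 2^-1 < j.+1%:R / 2 ^+ n by rewrite ltr_pdivlMr.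
    by rewrite -[j.+1%:R]natr1 mulrDl mul1r ltrBlDl addrA => /ltW.
  have a2 : 2^-1 <= grid n j :> R by rewrite /grid lerDl divr_ge0.
  have fa : 2 * `|f (grid n j)| <= C by apply: f_bounded; rewrite a2 (le_trans at_).
  have dY : `|rescaled f t - rescaled f (grid n j)| <= h * (k j)%:R.
    apply: (le_trans (rescaled_dist_le a2 at_ fa)).
    have l2 : 0 <= 2 / ln (2 : R) by rewrite divr_ge0// ln_ge0// ler1n.
    have s1 : 1 <= (interval_jumps f n j).+1%:R :> R by rewrite ler1n.
    have o : `|f t - f (grid n j)| <= C * h * (interval_jumps f n j).+1%:R.
      by apply: oscillation_le => //; rewrite at_.
    apply: (@le_trans _ _ (h * (B * (interval_jumps f n j).+1%:R))); last first.
      by rewrite ler_pM2l// natrM ler_wpM2r.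
    rewrite [leRHS](_ : _ = 2 * (C * h * (interval_jumps f n j).+1%:R) +
      (2 * C + 2 / ln 2) * (h * (interval_jumps f n j).+1%:R)); last by rewrite /B; ring.
    apply: lerD; first by rewrite ler_wpM2l.
    apply: ler_wpM2l; first by rewrite addr_ge0// mulr_ge0.
    apply: (@le_trans _ _ h); first by rewrite lerBlDl.
    by rewrite ler_peMr// ltW.
  move: dY; rewrite ler_norml => /andP[dY1 dY2].
  (* The shift by [k j] makes the height nonnegative, so that truncation yields the index of a
     centre. *)
  have y0 : 0 <= (rescaled f t - rescaled f (grid n j)) / h + (k j)%:R.
    by rewrite -lerBlDr sub0r ler_pdivlMr// mulNr mulrC.
  have /andP[i1 i2] := truncn_itv y0.
  set i := Num.truncn _ in i1 i2.
  exists (center j i).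
    apply: allpairs_f_dep; rewrite mem_iota add0n//=.
    rewrite ltnS -(ler_nat R) natrM; apply: (le_trans i1).
    by rewrite [leRHS]mulrDl mul1r lerD2r ler_pdivrMr// mulrC.
  have -> : 2 / 2 ^+ n = h + h by rewrite mulr_natl mulr2n.
  apply: mem_euclidean_closed_ball2; rewrite !mxE/=.
    by rewrite ger0_norm ?subr_ge0// lerBlDl.
  have dE : rescaled f t - rescaled f (grid n j) =
      h * ((rescaled f t - rescaled f (grid n j)) / h).
    by rewrite mulrCA divff ?mulr1// lt0r_neq0.
  rewrite opprD addrA dE -mulrBr normrM (gtr0_norm h0) ler_piMr ?(ltW h0)//.
  rewrite -[i.+1%:R]natr1 in i2.
  by rewrite ler_norml; apply/andP; split; lra.
rewrite size_s natr_sum.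
have -> : \sum_(j < (2 ^ n)%N) (2 * k j).+1%:R =
  (2 * A%:R + 1) * 2 ^+ n + 2 * A%:R * (2 ^+ n * jump_count f n) :> R.
  rewrite -sum_interval_jumps natr_sum mulr_sumr.
  have -> : (2 * A%:R + 1) * 2 ^+ n = \sum_(j < (2 ^ n)%N) (2 * A%:R + 1) :> R.
    by rewrite sumr_const card_ord -natrX [LHS]mulr_natr.
  rewrite -big_split/=; apply: eq_bigr => j _.
  rewrite /k -natr1 !natrM -natr1; ring.
have n4 : 1 <= n.+2%:R ^+ 4 :> R by rewrite exprn_ege1// ler1n.
rewrite [leRHS](_ : _ = (2 * (B + 1) * n.+2%:R ^+ 4 + n.+2%:R ^+ 4) * 2 ^+ n +
  2 * (B + 1) * (2 ^+ n * (K * n.+2%:R ^+ 4))); last by ring.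
have B0 : 0 <= B by exact: le_trans B_ge1.
have KJ : 0 <= K * n.+2%:R ^+ 4 by rewrite mulr_ge0// exprn_ge0.
apply: lerD.
  rewrite ler_pM2r// lerD//.
  rewrite -[leLHS]mulr1 ler_pM// ?mulr_ge0//; lra.
apply: (@le_trans _ _ (2 * A%:R * (2 ^+ n * (K * n.+2%:R ^+ 4)))).
  by apply: ler_wpM2l; [rewrite mulr_ge0|rewrite ler_pM2l].
apply: ler_wpM2r; first by rewrite mulr_ge0// ltW.
by rewrite ler_wpM2l.
Qed.

End RescaledGraph.

Theorem theorem2p7 (R : realType) (d : measure_display) (T : measurableType d)
    (P : probability T R) (phi : {measure set R -> \bar R})
    (phi_conc : phi (~` range (fun k : int => (2 : R) ^ k)) = 0%E)
    (phi_atom : forall k : int, phi [set (2 : R) ^ k] = ((2 : R) ^ (- k))%:E)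
    (X : R -> T -> R)
    (X_levy : levy_process P X)
    (X_char : forall t y : R, 0 <= t ->
       char_fun P (X t) y = cexp (t%:C%C * levy_exponent phi y)) :
  {ae P, forall w,
    has_box_dimension
      (graph_on `[2^-1, 1] (fun t => t^-1 * (X t w - t * log2 t))) 1}.
Proof.
have [_ _ _ _ X_cadlag] := X_levy.
have jumps := jump_count_ae phi_conc phi_atom X_levy X_char.
apply: filterS2 X_cadlag jumps => w cw [K K0 hK].
have [||M hM] := @cadlag_bounded R (X ^~ w) 2^-1 1 cw; [lra|lra|].
have M0 : 0 <= `|M| by [].
(* The 8 meets the requirement of [oscillation_le]; [M] carries no sign information, hence its
   absolute value. *)
pose C := 8 + 2 * `|M|.
have C8 : 8 <= C by rewrite /C lerDl mulr_ge0.
have hC s : 2^-1 <= s <= 1 -> 2 * `|X s w| <= C.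
  move=> /hM Xs; rewrite /C; have := le_trans Xs (ler_norm M); lra.
have D0 : 0 < 2 * (4 * C + 2 / ln 2 + 1) * (1 + K) + 1.
  have l2 : 0 <= ln (2 : R) by rewrite ln_ge0// ler1n.
  have C0 : 0 <= C by exact: le_trans C8.
  by rewrite ltr_wpDl// mulr_ge0 ?addr_ge0// mulr_ge0// !addr_ge0// mulr_ge0// invr_ge0.
apply: (has_box_dimension_one _ D0).
- exact: (rescaled_graph_bounded C8 hC).
- by move=> delta n d0; apply: coverable_graph_ge; exact: ltW.
- by move=> n; exact: (rescaled_graph_coverable cw C8 hC K0 (hK n)).
Qed.
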